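(* There is a class function $f:\mathrm{Ord}\to\mathrm{Ord}$ such that for every uplifting cardinal $\kappa$, the restriction $f\restriction\kappa$ maps $\kappa$ into $\kappa$, is a definable class in $V_\kappa$, and has the uplifting Menas property for $\kappa$. In particular, every uplifting cardinal has a function with the uplifting Menas property.
   Context: An inaccessible cardinal $\kappa$ is uplifting if for every ordinal $\theta$ there is an inaccessible $\gamma\ge\theta$ with $V_\kappa\prec V_\gamma$ a proper elementary extension. For an uplifting $\kappa$, a (partial) function $f:\kappa\to\kappa$ has the uplifting Menas property for $\kappa$ if for every ordinal $\theta$ there are an inaccessible cardinal $\gamma>\theta$ and a function $f^*:\gamma\to\gamma$ such that $\langle V_\kappa,\in,f\rangle\prec\langle V_\gamma,\in,f^*\rangle$ and $\theta\le f^*(\kappa)$. *)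

(* Defs.v *)
(** The theorem is a theorem (scheme) of ZFC.  It is rendered semantically: it
    is asserted in every model [M] of first-order ZFC, where "class" means
    "definable by a first-order formula".  All set-theoretic notions below are
    the usual first-order ones, evaluated inside [M].  In particular
    satisfaction and elementarity between sets of [M] refer to [M]'s own coded
    formulas, since the natural numbers of [M] may be nonstandard. *)

Record structure := Structure {
  carrier :> Type;
  mem : carrier -> carrier -> Prop
}.
Arguments mem {_} _ _.
Notation "x ∈ y" := (mem x y) (at level 70, no associativity).

(** ** Formulas of the language of set theory (de Bruijn indices) *)

Inductive formula : Type :=
| Fmem (i j : nat)
| Feq (i j : nat)
| Fneg (p : formula)
| Fand (p q : formula)
| Fex (p : formula).

Definition scons {T : Type} (x : T) (e : nat -> T) : nat -> T :=
  fun n => match n with 0 => x | S m => e m end.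

Fixpoint holds {M : structure} (p : formula) (e : nat -> M) : Prop :=
  match p with
  | Fmem i j => e i ∈ e j
  | Feq i j => e i = e j
  | Fneg p => ~ holds p e
  | Fand p q => holds p e /\ holds q e
  | Fex p => exists x : M, holds p (scons x e)
  end.

(** [p] defines the binary class [F] without parameters: the truth value of [p]
    depends only on the values of the variables 0 and 1. *)
Definition defines {M : structure} (p : formula) (F : M -> M -> Prop) : Prop :=
  forall e : nat -> M, holds p e <-> F (e 0) (e 1).

(** ** ZFC *)

Definition subset {M : structure} (x y : M) : Prop :=
  forall z : M, z ∈ x -> z ∈ y.

Definition is_empty {M : structure} (x : M) : Prop := forall z : M, ~ z ∈ x.

Definition is_pair {M : structure} (p x y : M) : Prop :=
  forall z : M, z ∈ p <-> z = x \/ z = y.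

Definition is_power {M : structure} (p x : M) : Prop :=
  forall z : M, z ∈ p <-> subset z x.

Definition is_succ {M : structure} (y x : M) : Prop :=
  forall z : M, z ∈ y <-> z ∈ x \/ z = x.

Definition inductive_set {M : structure} (w : M) : Prop :=
  (exists o : M, is_empty o /\ o ∈ w) /\
  (forall x : M, x ∈ w -> exists y : M, is_succ y x /\ y ∈ w).

Record ZFC (M : structure) : Prop := {
  zf_extensionality :
    forall x y : M, (forall z : M, z ∈ x <-> z ∈ y) -> x = y;
  zf_foundation :
    forall x : M, (exists y : M, y ∈ x) ->
      exists y : M, y ∈ x /\ forall z : M, z ∈ y -> ~ z ∈ x;
  zf_pairing :
    forall x y : M, exists p : M, is_pair p x y;
  zf_union :
    forall x : M, exists u : M,
      forall z : M, z ∈ u <-> exists y : M, y ∈ x /\ z ∈ y;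
  zf_power :
    forall x : M, exists p : M, is_power p x;
  zf_infinity :
    exists w : M, inductive_set w;
  zf_separation :
    forall (p : formula) (e : nat -> M) (a : M), exists b : M,
      forall x : M, x ∈ b <-> x ∈ a /\ holds p (scons x e);
  zf_replacement :
    forall (p : formula) (e : nat -> M) (a : M),
      (forall x : M, x ∈ a -> exists! y : M, holds p (scons x (scons y e))) ->
      exists b : M, forall y : M,
        y ∈ b <-> exists x : M, x ∈ a /\ holds p (scons x (scons y e));
  zf_choice :
    forall a : M,
      (forall x : M, x ∈ a -> exists y : M, y ∈ x) ->
      (forall x y z : M, x ∈ a -> y ∈ a -> z ∈ x -> z ∈ y -> x = y) ->
      exists c : M, forall x : M, x ∈ a -> exists! y : M, y ∈ x /\ y ∈ c
}.

(** ** Ordinals, functions, cardinals *)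

Definition transitive_set {M : structure} (x : M) : Prop :=
  forall y : M, y ∈ x -> subset y x.

(* Linearity suffices for well-ordering, by foundation. *)
Definition ordinal {M : structure} (x : M) : Prop :=
  transitive_set x /\
  forall y z : M, y ∈ x -> z ∈ x -> y ∈ z \/ y = z \/ z ∈ y.

Definition ord_le {M : structure} (a b : M) : Prop := a ∈ b \/ a = b.

(* Kuratowski's {{a}, {a, b}}. *)
Definition is_opair {M : structure} (p a b : M) : Prop :=
  forall z : M, z ∈ p <-> is_pair z a a \/ is_pair z a b.

Definition rel {M : structure} (r a b : M) : Prop :=
  exists p : M, is_opair p a b /\ p ∈ r.

Definition partial_function {M : structure} (f A B : M) : Prop :=
  (forall p : M, p ∈ f ->
     exists a b : M, a ∈ A /\ b ∈ B /\ is_opair p a b) /\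
  (forall a b b' : M, rel f a b -> rel f a b' -> b = b').

Definition total_function {M : structure} (f A B : M) : Prop :=
  partial_function f A B /\ forall a : M, a ∈ A -> exists b : M, rel f a b.

Definition equinumerous {M : structure} (A B : M) : Prop :=
  exists f : M, total_function f A B /\
    (forall a a' b : M, rel f a b -> rel f a' b -> a = a') /\
    (forall b : M, b ∈ B -> exists a : M, rel f a b).

Definition is_omega {M : structure} (w : M) : Prop :=
  inductive_set w /\ forall v : M, inductive_set v -> subset w v.

Definition cardinal {M : structure} (k : M) : Prop :=
  ordinal k /\ forall a : M, a ∈ k -> ~ equinumerous a k.

(* Every function from a smaller ordinal into [k] is bounded in [k]. *)
Definition regular {M : structure} (k : M) : Prop :=
  forall a g : M, a ∈ k -> total_function g a k ->
    exists b : M, b ∈ k /\ forall x y : M, rel g x y -> y ∈ b.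

Definition strong_limit {M : structure} (k : M) : Prop :=
  forall a : M, a ∈ k ->
    exists p b : M, is_power p a /\ b ∈ k /\ equinumerous p b.

Definition inaccessible {M : structure} (k : M) : Prop :=
  cardinal k /\ (exists w : M, is_omega w /\ w ∈ k) /\
  regular k /\ strong_limit k.

(** [v] is V_a, by the recursion V_b = ⋃_{c < b} P(V_c), carried out by a
    function [h] with domain a + 1. *)
Definition is_V {M : structure} (a v : M) : Prop :=
  ordinal a /\
  exists h d B : M, is_succ d a /\ total_function h d B /\
    (forall b y : M, rel h b y ->
       forall z : M, z ∈ y <->
         exists c x : M, c ∈ b /\ rel h c x /\ subset z x) /\
    rel h a v.

(** ** Coded formulas and satisfaction inside [M]

    A structure is a domain [A : M] with membership and, for [R = Some f], also
    the graph of a partial function [f].  Variables are indexed by the elements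
    of [M]'s ω, and assignments are functions from ω to [A]. *)

Fixpoint is_num {M : structure} (n : nat) (x : M) : Prop :=
  match n with
  | 0 => is_empty x
  | S m => exists y : M, is_num m y /\ is_succ x y
  end.

Definition tagged {M : structure} (n : nat) (c x : M) : Prop :=
  exists t : M, is_num n t /\ is_opair c t x.

Definition tagged2 {M : structure} (n : nat) (c x y : M) : Prop :=
  exists p : M, is_opair p x y /\ tagged n c p.

Definition code_mem {M : structure} : M -> M -> M -> Prop := tagged2 0.
Definition code_eq {M : structure} : M -> M -> M -> Prop := tagged2 1.
Definition code_fun {M : structure} : M -> M -> M -> Prop := tagged2 2.
Definition code_neg {M : structure} : M -> M -> Prop := tagged 3.
Definition code_and {M : structure} : M -> M -> M -> Prop := tagged2 4.
Definition code_ex {M : structure} : M -> M -> M -> Prop := tagged2 5.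

(* [b] tells whether the language contains the function symbol. *)
Definition formula_closed {M : structure} (b : bool) (w C : M) : Prop :=
  (forall c i j : M, i ∈ w -> j ∈ w -> code_mem c i j -> c ∈ C) /\
  (forall c i j : M, i ∈ w -> j ∈ w -> code_eq c i j -> c ∈ C) /\
  (b = true ->
   forall c i j : M, i ∈ w -> j ∈ w -> code_fun c i j -> c ∈ C) /\
  (forall c p : M, p ∈ C -> code_neg c p -> c ∈ C) /\
  (forall c p q : M, p ∈ C -> q ∈ C -> code_and c p q -> c ∈ C) /\
  (forall c i p : M, i ∈ w -> p ∈ C -> code_ex c i p -> c ∈ C).

(** [F] is the set of all coded formulas of the language. *)
Definition is_formulas {M : structure} (b : bool) (F : M) : Prop :=
  exists w : M, is_omega w /\ formula_closed b w F /\
    forall C : M, formula_closed b w C -> subset F C.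

Definition has_fun {M : structure} (R : option M) : bool :=
  match R with Some _ => true | None => false end.

Definition fun_rel {M : structure} (R : option M) (x y : M) : Prop :=
  match R with Some f => rel f x y | None => False end.

(** Tarski's clauses: [T] relates a coded formula to an assignment exactly when
    the formula is true in (A, ∈, R) under the assignment. *)
Definition is_truth {M : structure} (A : M) (R : option M) (T : M) : Prop :=
  exists w F : M, is_omega w /\ is_formulas (has_fun R) F /\
  forall s : M, total_function s w A ->
    (forall c i j : M, i ∈ w -> j ∈ w -> code_mem c i j ->
       (rel T c s <-> exists x y : M, rel s i x /\ rel s j y /\ x ∈ y)) /\
    (forall c i j : M, i ∈ w -> j ∈ w -> code_eq c i j ->
       (rel T c s <-> exists x y : M, rel s i x /\ rel s j y /\ x = y)) /\
    (has_fun R = true ->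
     forall c i j : M, i ∈ w -> j ∈ w -> code_fun c i j ->
       (rel T c s <-> exists x y : M, rel s i x /\ rel s j y /\ fun_rel R x y)) /\
    (forall c p : M, p ∈ F -> code_neg c p -> (rel T c s <-> ~ rel T p s)) /\
    (forall c p q : M, p ∈ F -> q ∈ F -> code_and c p q ->
       (rel T c s <-> rel T p s /\ rel T q s)) /\
    (forall c i p : M, i ∈ w -> p ∈ F -> code_ex c i p ->
       (rel T c s <->
        exists s' : M, total_function s' w A /\
          (forall j x : M, j <> i -> (rel s' j x <-> rel s j x)) /\
          rel T p s')).

Definition satisfies {M : structure} (A : M) (R : option M) (c s : M) : Prop :=
  exists T : M, is_truth A R T /\ rel T c s.

(** (A, ∈, R) ≺ (B, ∈, S), for structures in the same language. *)
Definition elementary {M : structure} (A : M) (R : option M)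
    (B : M) (S : option M) : Prop :=
  has_fun R = has_fun S /\ subset A B /\
  forall w F c s : M, is_omega w -> is_formulas (has_fun R) F -> c ∈ F ->
    total_function s w A -> (satisfies A R c s <-> satisfies B S c s).

(** The binary relation [f] is definable without parameters in (A, ∈): the truth
    value of the formula [c] depends only on the variables 0 and 1. *)
Definition definable_in {M : structure} (A f : M) : Prop :=
  exists w F c : M, is_omega w /\ is_formulas false F /\ c ∈ F /\
    forall s i0 i1 x y : M, total_function s w A ->
      is_num 0 i0 -> is_num 1 i1 -> rel s i0 x -> rel s i1 y ->
      (satisfies A None c s <-> rel f x y).

(** ** Uplifting cardinals *)

Definition uplifting {M : structure} (k : M) : Prop :=
  inaccessible k /\
  forall th : M, ordinal th ->
    exists g Vk Vg : M, inaccessible g /\ ord_le th g /\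
      is_V k Vk /\ is_V g Vg /\ elementary Vk None Vg None /\ Vk <> Vg.

Definition uplifting_Menas {M : structure} (k f : M) : Prop :=
  partial_function f k k /\
  forall th : M, ordinal th ->
    exists g fs Vk Vg : M, inaccessible g /\ th ∈ g /\
      partial_function fs g g /\
      is_V k Vk /\ is_V g Vg /\ elementary Vk (Some f) Vg (Some fs) /\
      exists d : M, rel fs k d /\ ord_le th d.

(** ** Class functions *)

Definition ord_class_function {M : structure} (F : M -> M -> Prop) : Prop :=
  (forall a b : M, F a b -> ordinal a /\ ordinal b) /\
  (forall a : M, ordinal a -> exists! b : M, F a b).

Definition is_restriction {M : structure} (F : M -> M -> Prop) (k f : M) : Prop :=
  forall p : M, p ∈ f <-> exists a b : M, a ∈ k /\ F a b /\ is_opair p a b.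

(* Main.v *)
From Stdlib Require Import Classical ClassicalEpsilon ProofIrrelevance.
From Stdlib Require Import FunctionalExtensionality Arith Lia.
Require Import Defs.

(** Call an inaccessible [g] a target of [b] when [V_b] is elementary in [V_g].  The
    function sends an ordinal [b] to the least strict upper bound of its targets, or
    to 0 if the targets of [b] are unbounded.  Being a target is absolute between the
    universe and any [V_g] with [g] inaccessible.  Since an uplifting [k] has
    arbitrarily large targets, elementarity shows that [V_k] computes the function
    correctly on [k].  Given an ordinal [th], take a target [g0 > th] of [k] and let
    [g] be the least target of [k] above [g0].  The largest target of [k] which [V_g]
    sees is [g0], so [V_g] computes the value [g0 + 1 > th] at [k].  The expansions of
    [V_k] and [V_g] by the function are definable by one standard formula, so
    elementarity carries over to the expanded structures.  For the possibly
    nonstandard formulas of the model this is shown by induction inside the model,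
    where only the existence of a translation into the language of [∈] is needed. *)

(** * Definability with parameters *)

(** In the universe the function takes the value 0 at an uplifting [k], because the targets of [k]
    are unbounded. So [f*] cannot be the restriction of the class function to [g]: it is what the
    same formula defines inside [V_g], where targets at or above [g] are invisible. The large value
    at [k] comes exactly from this disagreement, whereas below [k] there is none. For this reason
    [target], [target_bound] and [menas] are stated for an arbitrary structure, and one formula is
    read in [M], in [V_k] and in [V_g]. The levels are never shown to be models of [ZFC]; facts
    about them are carried over from [M] by absoluteness, which holds because such a level contains
    all subsets of its members and is closed under power sets.

    Two kinds of formulas have to be kept apart. [formula] is external and serves the schemes of
    separation and replacement, while [elementary] speaks of the codes of [M]. An external formula
    has a code, but not every code comes from one, so arguments about all codes must be inductions
    inside [M] on definable predicates. This is what the calculus of [Def] is for. *)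

Fixpoint ren (r : nat -> nat) (p : formula) : formula :=
  match p with
  | Fmem i j => Fmem (r i) (r j)
  | Feq i j => Feq (r i) (r j)
  | Fneg p => Fneg (ren r p)
  | Fand p q => Fand (ren r p) (ren r q)
  | Fex p => Fex (ren (fun n => match n with 0 => 0 | S m => S (r m) end) p)
  end.

Lemma exists_iff_compat {T : Type} (P Q : T -> Prop) :
  (forall x, P x <-> Q x) -> ((exists x, P x) <-> (exists x, Q x)).
Proof. intros H; split; intros [x Hx]; exists x; apply H, Hx. Qed.

Lemma holds_ren {M : structure} (p : formula) :
  forall (r : nat -> nat) (e e' : nat -> M),
    (forall n, e' n = e (r n)) -> (holds (ren r p) e <-> holds p e').
Proof.
  induction p as [i j|i j|p IH|p IHp q IHq|p IH]; intros r e e' H; simpl.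
  - rewrite !H; tauto.
  - rewrite !H; tauto.
  - rewrite (IH r e e' H); tauto.
  - rewrite (IHp r e e' H), (IHq r e e' H); tauto.
  - split; intros [x Hx]; exists x; revert Hx; apply IH;
      intros [|n]; simpl; auto.
Qed.

Lemma holds_ext {M : structure} (p : formula) (e e' : nat -> M) :
  (forall n, e n = e' n) -> (holds p e <-> holds p e').
Proof.
  intros H. replace e' with e; [tauto|].
  apply functional_extensionality; exact H.
Qed.

(** Definability is relative to a family of structures: a family with one member
    serves for the separation schema of a fixed model, and the family of all
    structures gives one formula which works in every structure. *)
Section Definability.
Context {I : Type} {Ms : I -> structure}.

Definition sel : Type := (nat + (forall i : I, Ms i))%type.

Definition ev (g : sel) (i : I) (e : nat -> Ms i) : Ms i :=
  match g with inl n => e n | inr c => c i end.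

Definition Tm (t : forall i : I, (nat -> Ms i) -> Ms i) : Prop :=
  exists g : sel, forall i e, t i e = ev g i e.

(** The map [g] fills each free variable of [p] with a variable of the context or with a parameter,
    so parameters never have to be listed or renumbered. *)
Definition Def (Q : forall i : I, (nat -> Ms i) -> Prop) : Prop :=
  exists (p : formula) (g : nat -> sel), forall i e,
    holds p (fun k => ev (g k) i e) <-> Q i e.

Lemma Tm_var (n : nat) : Tm (fun i e => e n).
Proof. exists (inl n); reflexivity. Qed.

Lemma Tm_cst (c : forall i : I, Ms i) : Tm (fun i e => c i).
Proof. exists (inr c); reflexivity. Qed.

Lemma Tm_ren (t : forall i : I, (nat -> Ms i) -> Ms i) (r : nat -> nat) :
  Tm t -> Tm (fun i e => t i (fun n => e (r n))).
Proof.
  intros [[n|c] H].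
  - exists (inl (r n)); intros i e; rewrite H; reflexivity.
  - exists (inr c); intros i e; rewrite H; reflexivity.
Qed.

Lemma Def_iff (Q Q' : forall i : I, (nat -> Ms i) -> Prop) :
  (forall i e, Q i e <-> Q' i e) -> Def Q -> Def Q'.
Proof.
  intros H [p [g Hp]]; exists p, g; intros i e. rewrite Hp; apply H.
Qed.

Lemma Def_ren (Q : forall i : I, (nat -> Ms i) -> Prop) (r : nat -> nat) :
  Def Q -> Def (fun i e => Q i (fun n => e (r n))).
Proof.
  intros [p [g Hp]].
  exists p, (fun k => match g k with inl n => inl (r n) | h => h end).
  intros i e. rewrite <- Hp. apply holds_ext. intros k.
  destruct (g k); reflexivity.
Qed.

Lemma Def_mem (t u : forall i : I, (nat -> Ms i) -> Ms i) :
  Tm t -> Tm u -> Def (fun i e => t i e ∈ u i e).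
Proof.
  intros [g Hg] [h Hh]. exists (Fmem 0 1), (scons g (fun _ => h)).
  intros i e; simpl. rewrite Hg, Hh; tauto.
Qed.

Lemma Def_eq (t u : forall i : I, (nat -> Ms i) -> Ms i) :
  Tm t -> Tm u -> Def (fun i e => t i e = u i e).
Proof.
  intros [g Hg] [h Hh]. exists (Feq 0 1), (scons g (fun _ => h)).
  intros i e; simpl. rewrite Hg, Hh; tauto.
Qed.

Lemma Def_not (Q : forall i : I, (nat -> Ms i) -> Prop) :
  Def Q -> Def (fun i e => ~ Q i e).
Proof.
  intros [p [g Hp]]. exists (Fneg p), g. intros i e; simpl.
  rewrite Hp; tauto.
Qed.

(** The two formulas may fill the same variable differently. Their variables are therefore moved to
    even and odd positions, and the two fillings are interleaved. *)
Lemma Def_and (Q Q' : forall i : I, (nat -> Ms i) -> Prop) :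
  Def Q -> Def Q' -> Def (fun i e => Q i e /\ Q' i e).
Proof.
  intros [p [g Hp]] [q [h Hq]].
  exists (Fand (ren (fun k => 2 * k) p) (ren (fun k => 2 * k + 1) q)),
    (fun k => if Nat.even k then g (Nat.div2 k) else h (Nat.div2 k)).
  intros i e; cbn [holds].
  rewrite (holds_ren p _ _ (fun k => ev (g k) i e)),
    (holds_ren q _ _ (fun k => ev (h k) i e)), Hp, Hq; [tauto| |]; cbv beta.
  - intros n. rewrite Nat.even_add, Nat.even_mul, Nat.add_1_r, Nat.div2_succ_double.
    reflexivity.
  - intros n. rewrite Nat.even_mul, Nat.div2_double; reflexivity.
Qed.

(** All variables of [p] that are filled with context variable 0 become the bound variable; the
    others are shifted past the quantifier and their filling is lowered by one. *)
Lemma Def_ex (Q : forall i : I, (nat -> Ms i) -> Ms i -> Prop) :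
  Def (fun i e => Q i (fun n => e (S n)) (e 0)) ->
  Def (fun i e => exists x : Ms i, Q i e x).
Proof.
  intros [p [g Hp]].
  exists (Fex (ren (fun k => match g k with inl 0 => 0 | _ => S k end) p)),
    (fun k => match g k with inl (S n) => inl n | h => h end).
  intros i e; cbn [holds].
  apply exists_iff_compat; intros x.
  rewrite (holds_ren p _ _ (fun k => ev (g k) i (scons x e))), Hp.
  - simpl. replace (fun n => e n) with e; [tauto|reflexivity].
  - intros k. destruct (g k) as [[|n]|c] eqn:E; simpl; rewrite ?E; reflexivity.
Qed.

Lemma Def_all (Q : forall i : I, (nat -> Ms i) -> Ms i -> Prop) :
  Def (fun i e => Q i (fun n => e (S n)) (e 0)) ->
  Def (fun i e => forall x : Ms i, Q i e x).
Proof.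
  intros H. apply (Def_iff (fun i e => ~ exists x : Ms i, ~ Q i e x)).
  - intros i e; split; [|intros H1 [x Hx]; auto].
    intros H1 x. apply NNPP; intros H2; apply H1; exists x; exact H2.
  - apply Def_not, (Def_ex (fun i e x => ~ Q i e x)), Def_not, H.
Qed.

Lemma Def_or (Q Q' : forall i : I, (nat -> Ms i) -> Prop) :
  Def Q -> Def Q' -> Def (fun i e => Q i e \/ Q' i e).
Proof.
  intros H H'. apply (Def_iff (fun i e => ~ (~ Q i e /\ ~ Q' i e))).
  - intros i e; tauto.
  - apply Def_not, Def_and; apply Def_not; assumption.
Qed.

Lemma Def_imp (Q Q' : forall i : I, (nat -> Ms i) -> Prop) :
  Def Q -> Def Q' -> Def (fun i e => Q i e -> Q' i e).
Proof.
  intros H H'. apply (Def_iff (fun i e => ~ (Q i e /\ ~ Q' i e))).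
  - intros i e; tauto.
  - apply Def_not, Def_and; [|apply Def_not]; assumption.
Qed.

Lemma Def_equiv (Q Q' : forall i : I, (nat -> Ms i) -> Prop) :
  Def Q -> Def Q' -> Def (fun i e => Q i e <-> Q' i e).
Proof. intros H H'. apply Def_and; apply Def_imp; assumption. Qed.

(** Needed for external side conditions such as [b = true]: by excluded middle they amount to a
    trivially true or a trivially false formula. *)
Lemma Def_const (C : Prop) : Def (fun i e => C).
Proof.
  destruct (classic C) as [HC|HC].
  - exists (Feq 0 0), (fun _ => inl 0); simpl; tauto.
  - exists (Fneg (Feq 0 0)), (fun _ => inl 0); simpl; tauto.
Qed.

End Definability.

Ltac tm :=
  cbv beta;
  first
  [ apply Tm_var
  | match goal with |- Tm (fun i e => ?c) => exact (Tm_cst (fun _ => c)) end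
  | match goal with H : Tm ?t |- _ => exact H end
  | match goal with H : Tm ?t |- _ => exact (Tm_ren t _ H) end ].

(** A hook, reassigned as lemmas on named notions become available. *)
Ltac def_named := fail.

Ltac def_step :=
  cbv beta;
  lazymatch goal with
  | |- Tm _ => tm
  | |- _ =>
  first
  [ assumption
  | apply Def_const
  | apply Def_mem
  | apply Def_eq
  | def_named
  | apply Def_equiv
  | apply Def_and
  | apply Def_or
  | apply Def_not
  | apply Def_ex
  | apply Def_all
  | apply Def_imp ]
  end.

Ltac def := repeat def_step.

(** * Definability of the set-theoretic notions *)

Section DefinableNotions.
Context {I : Type} {Ms : I -> structure}.
Implicit Types t u v : forall i : I, (nat -> Ms i) -> Ms i.

Lemma Def_subset t u : Tm t -> Tm u -> Def (fun i e => subset (t i e) (u i e)).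
Proof. intros; unfold subset; def. Qed.

Lemma Def_is_empty t : Tm t -> Def (fun i e => is_empty (t i e)).
Proof. intros; unfold is_empty; def. Qed.

Lemma Def_is_pair t u v :
  Tm t -> Tm u -> Tm v -> Def (fun i e => is_pair (t i e) (u i e) (v i e)).
Proof. intros; unfold is_pair; def. Qed.

Lemma Def_is_power t u : Tm t -> Tm u -> Def (fun i e => is_power (t i e) (u i e)).
Proof. intros; unfold is_power; def. Qed.

Lemma Def_is_succ t u : Tm t -> Tm u -> Def (fun i e => is_succ (t i e) (u i e)).
Proof. intros; unfold is_succ; def. Qed.

Lemma Def_is_opair t u v :
  Tm t -> Tm u -> Tm v -> Def (fun i e => is_opair (t i e) (u i e) (v i e)).
Proof. intros; unfold is_opair; def. Qed.

Lemma Def_inductive_set t : Tm t -> Def (fun i e => inductive_set (t i e)).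
Proof. intros; unfold inductive_set; def. Qed.

Lemma Def_ordinal t : Tm t -> Def (fun i e => ordinal (t i e)).
Proof. intros; unfold ordinal, transitive_set; def. Qed.

Lemma Def_rel t u v :
  Tm t -> Tm u -> Tm v -> Def (fun i e => rel (t i e) (u i e) (v i e)).
Proof. intros; unfold rel; def. Qed.

Lemma Def_total_function t u v :
  Tm t -> Tm u -> Tm v ->
  Def (fun i e => total_function (t i e) (u i e) (v i e)).
Proof. intros; unfold total_function, partial_function; def. Qed.

Lemma Def_is_omega t : Tm t -> Def (fun i e => is_omega (t i e)).
Proof. intros; unfold is_omega; def. Qed.

Lemma Def_is_num n t : Tm t -> Def (fun i e => is_num n (t i e)).
Proof.
  revert t; induction n as [|n IH]; intros t Ht; simpl.
  - apply Def_is_empty; exact Ht.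
  - apply Def_ex, Def_and; [apply IH|apply Def_is_succ]; tm.
Qed.

(** [is_num n] recurses on [n], so it has no fixed shape on which the rules for connectives could
    act. *)
Ltac def_named ::= apply Def_is_num.

Lemma Def_equinumerous t u :
  Tm t -> Tm u -> Def (fun i e => equinumerous (t i e) (u i e)).
Proof. intros; unfold equinumerous; def. Qed.

Lemma Def_is_V t u : Tm t -> Tm u -> Def (fun i e => is_V (t i e) (u i e)).
Proof. intros; unfold is_V; def. Qed.

Lemma Def_tagged n t u :
  Tm t -> Tm u -> Def (fun i e => tagged n (t i e) (u i e)).
Proof. intros; unfold tagged; def. Qed.

Lemma Def_tagged2 n t u v :
  Tm t -> Tm u -> Tm v -> Def (fun i e => tagged2 n (t i e) (u i e) (v i e)).
Proof.
  intros; unfold tagged2. apply Def_ex, Def_and; [def|apply Def_tagged; tm].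
Qed.

Lemma Def_inaccessible t : Tm t -> Def (fun i e => inaccessible (t i e)).
Proof.
  intros; unfold inaccessible, cardinal, regular, strong_limit; def.
Qed.

Lemma Def_formula_closed b t u :
  Tm t -> Tm u -> Def (fun i e => formula_closed b (t i e) (u i e)).
Proof.
  intros; unfold formula_closed, code_mem, code_eq, code_fun, code_neg, code_and,
    code_ex; def.
Qed.

Lemma Def_is_formulas b t : Tm t -> Def (fun i e => is_formulas b (t i e)).
Proof.
  intros; unfold is_formulas.
  apply Def_ex, Def_and; [def|apply Def_and; [apply Def_formula_closed; tm|]].
  apply Def_all, Def_imp; [apply Def_formula_closed; tm|def].
Qed.

Lemma Def_is_truth_None t u :
  Tm t -> Tm u -> Def (fun i e => is_truth (t i e) None (u i e)).
Proof.
  intros; unfold is_truth, code_mem, code_eq, code_fun, code_neg, code_and,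
    code_ex; simpl has_fun.
  apply Def_ex, Def_ex, Def_and; [def|apply Def_and; [apply Def_is_formulas; tm|]].
  unfold fun_rel; def.
Qed.

Lemma Def_satisfies_None t u v :
  Tm t -> Tm u -> Tm v ->
  Def (fun i e => satisfies (t i e) None (u i e) (v i e)).
Proof.
  intros; unfold satisfies.
  apply Def_ex, Def_and; [apply Def_is_truth_None; tm|def].
Qed.

Lemma Def_elementary_None t u :
  Tm t -> Tm u -> Def (fun i e => elementary (t i e) None (u i e) None).
Proof.
  intros; unfold elementary. simpl has_fun.
  apply Def_and; [def|apply Def_and; [def|]].
  do 4 apply Def_all. apply Def_imp; [def|].
  apply Def_imp; [apply Def_is_formulas; tm|].
  do 2 (apply Def_imp; [def|]).
  apply Def_equiv; apply Def_satisfies_None; tm.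
Qed.

End DefinableNotions.

Ltac def_set_theory := first [apply Def_subset | apply Def_is_empty
  | apply Def_is_pair | apply Def_is_power | apply Def_is_succ
  | apply Def_is_opair | apply Def_inductive_set
  | apply Def_ordinal | apply Def_rel
  | apply Def_total_function | apply Def_is_omega
  | apply Def_is_num | apply Def_equinumerous
  | apply Def_is_V | apply Def_tagged | apply Def_tagged2
  | apply Def_inaccessible | apply Def_formula_closed
  | apply Def_is_formulas | apply Def_elementary_None].

Ltac def_named ::= def_set_theory.

(** A parameter [forall M : structure, M] cannot exist because a structure may be
    empty, so definability over all structures is parameter-free. *)
Lemma Def_uniform (Q : forall M : structure, (nat -> M) -> Prop) :
  Def (I := structure) (Ms := fun M => M) Q ->
  exists p : formula, forall (M : structure) (e : nat -> M), holds p e <-> Q M e.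
Proof.
  intros [p [g Hp]].
  assert (Hg : forall k, exists n, g k = inl n).
  { intros k. destruct (g k) as [n|c]; [exists n; reflexivity|].
    destruct (c (Structure False (fun _ _ => False))). }
  set (r := fun k => match g k with inl n => n | inr _ => 0 end).
  exists (ren r p). intros M e. rewrite <- Hp.
  apply holds_ren. intros n. unfold r. destruct (Hg n) as [m ->]. reflexivity.
Qed.

(** * Elementary set theory inside a model *)

Existing Class ZFC.

Notation Def1 P := (Def (I := unit) (Ms := fun _ => _) (fun _ e => P (e 0))).
Notation Def2 P := (Def (I := unit) (Ms := fun _ => _) (fun _ e => P (e 0) (e 1))).

Section SetTheory.
Context {M : structure} {HZ : ZFC M}.
Implicit Types a b c d f g h o p r s t u v w x y z A B C : M.

Lemma set_ext x y : (forall z, z ∈ x <-> z ∈ y) -> x = y.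
Proof. apply zf_extensionality, HZ. Qed.

Lemma separation (P : M -> Prop) a :
  Def1 P -> exists b, forall x, x ∈ b <-> x ∈ a /\ P x.
Proof.
  intros [p [g Hp]].
  destruct (zf_separation M HZ
    (ren (fun k => match g k with inl 0 => 0 | _ => S k end) p)
    (fun k => ev (g k) tt (fun _ => a)) a) as [b Hb].
  exists b. intros x. rewrite Hb.
  rewrite (holds_ren p _ _ (fun k => ev (g k) tt (scons x (fun _ => a)))).
  - rewrite Hp. reflexivity.
  - intros k. destruct (g k) as [[|n]|c] eqn:E; simpl; rewrite ?E; reflexivity.
Qed.

Lemma replacement (P : M -> M -> Prop) a :
  Def2 P -> (forall x, x ∈ a -> exists! y, P x y) ->
  exists b, forall y, y ∈ b <-> exists x, x ∈ a /\ P x y.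
Proof.
  intros [p [g Hp]] Hu.
  pose (q := ren (fun k => match g k with inl 0 => 0 | inl 1 => 1 | _ => S (S k) end) p).
  pose (e := fun k => ev (g k) tt (fun _ => a)).
  assert (Hq : forall x y, holds q (scons x (scons y e)) <-> P x y).
  { intros x y. unfold q.
    rewrite (holds_ren p _ _ (fun k => ev (g k) tt (scons x (scons y (fun _ => a))))).
    - rewrite Hp. reflexivity.
    - intros k. unfold e.
      destruct (g k) as [[|[|n]]|c] eqn:E; simpl; rewrite ?E; reflexivity. }
  destruct (zf_replacement M HZ q e a) as [b Hb].
  - intros x Hx. destruct (Hu x Hx) as [y [Hy1 Hy2]]. exists y. split.
    + apply Hq, Hy1.
    + intros y' Hy'. apply Hy2, Hq, Hy'.
  - exists b. intros y. rewrite Hb.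
    split; intros [x [Hx1 Hx2]]; exists x; (split; [exact Hx1|apply Hq, Hx2]).
Qed.

(** Choice in the metatheory turns the existence axioms into terms. Such terms are not part of the
    language, so predicates that must be definable keep the relational forms ([is_opair], [tagged])
    wherever bound variables are involved. *)
Definition the (P : M -> Prop) (H : exists x, P x) : M :=
  proj1_sig (constructive_indefinite_description P H).

Lemma the_spec (P : M -> Prop) (H : exists x, P x) : P (the P H).
Proof. unfold the. destruct constructive_indefinite_description; assumption. Qed.

Lemma empty_exists : exists o, is_empty o.
Proof. destruct (zf_infinity M HZ) as [w [[o [Ho _]] _]]. exists o; exact Ho. Qed.

Definition emp : M := the _ empty_exists.

Lemma emp_spec z : ~ z ∈ emp.
Proof. exact (the_spec _ empty_exists z). Qed.

Lemma is_empty_iff x : is_empty x <-> x = emp.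
Proof.
  split.
  - intros H. apply set_ext; intros z. split; [intros Hz; destruct (H z Hz)|].
    intros Hz; destruct (emp_spec z Hz).
  - intros ->. exact emp_spec.
Qed.

Definition upair x y : M := the _ (zf_pairing M HZ x y).

Lemma upair_spec x y z : z ∈ upair x y <-> z = x \/ z = y.
Proof. exact (the_spec _ (zf_pairing M HZ x y) z). Qed.

Lemma is_pair_iff p x y : is_pair p x y <-> p = upair x y.
Proof.
  split.
  - intros H. apply set_ext; intros z. rewrite (H z), upair_spec; tauto.
  - intros -> z. apply upair_spec.
Qed.

Definition opr x y : M := upair (upair x x) (upair x y).

Lemma is_opair_iff p x y : is_opair p x y <-> p = opr x y.
Proof.
  unfold is_opair. split.
  - intros H. apply set_ext; intros z.
    rewrite H, !is_pair_iff. unfold opr. rewrite upair_spec; tauto.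
  - intros -> z. unfold opr. rewrite upair_spec, !is_pair_iff; tauto.
Qed.

Lemma upair_inj x y x' y' :
  upair x y = upair x' y' -> (x = x' /\ y = y') \/ (x = y' /\ y = x').
Proof.
  intros H.
  assert (H1 : x ∈ upair x' y') by (rewrite <- H; apply upair_spec; auto).
  assert (H2 : y ∈ upair x' y') by (rewrite <- H; apply upair_spec; auto).
  assert (H3 : x' ∈ upair x y) by (rewrite H; apply upair_spec; auto).
  assert (H4 : y' ∈ upair x y) by (rewrite H; apply upair_spec; auto).
  rewrite upair_spec in *.
  destruct H1, H2, H3, H4; subst; auto.
Qed.

Lemma opr_inj x y x' y' : opr x y = opr x' y' -> x = x' /\ y = y'.
Proof.
  unfold opr. intros H.
  destruct (upair_inj _ _ _ _ H) as [[H1 H2]|[H1 H2]];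
    apply upair_inj in H1; apply upair_inj in H2;
    destruct H1 as [[? ?]|[? ?]], H2 as [[? ?]|[? ?]]; subst; auto.
Qed.

Lemma rel_iff r a b : rel r a b <-> opr a b ∈ r.
Proof.
  unfold rel. split.
  - intros [p [Hp Hr]]. apply is_opair_iff in Hp. subst; exact Hr.
  - intros H. exists (opr a b). split; [apply is_opair_iff; reflexivity|exact H].
Qed.

Definition powS x : M := the _ (zf_power M HZ x).

Lemma powS_spec x z : z ∈ powS x <-> subset z x.
Proof. exact (the_spec _ (zf_power M HZ x) z). Qed.

Lemma is_power_iff p x : is_power p x <-> p = powS x.
Proof.
  split.
  - intros H. apply set_ext; intros z. rewrite (H z), powS_spec; tauto.
  - intros -> z. apply powS_spec.
Qed.

Definition unionS x : M := the _ (zf_union M HZ x).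

Lemma unionS_spec x z : z ∈ unionS x <-> exists y, y ∈ x /\ z ∈ y.
Proof. exact (the_spec _ (zf_union M HZ x) z). Qed.

Definition cup x y : M := unionS (upair x y).

Lemma cup_spec x y z : z ∈ cup x y <-> z ∈ x \/ z ∈ y.
Proof.
  unfold cup. rewrite unionS_spec. split.
  - intros [u [Hu Hz]]. apply upair_spec in Hu. destruct Hu; subst; auto.
  - intros [H|H]; [exists x|exists y]; rewrite upair_spec; auto.
Qed.

Definition succS x : M := cup x (upair x x).

Lemma succS_spec x z : z ∈ succS x <-> z ∈ x \/ z = x.
Proof. unfold succS. rewrite cup_spec, upair_spec; tauto. Qed.

Lemma is_succ_iff y x : is_succ y x <-> y = succS x.
Proof.
  split.
  - intros H. apply set_ext; intros z. rewrite (H z), succS_spec; tauto.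
  - intros -> z. apply succS_spec.
Qed.

Lemma subset_refl x : subset x x.
Proof. intros z; auto. Qed.

Lemma subset_antisym x y : subset x y -> subset y x -> x = y.
Proof. intros H H'. apply set_ext; intros z; split; auto. Qed.

Lemma opr_in_pow x y C : x ∈ C -> y ∈ C -> opr x y ∈ powS (powS C).
Proof.
  intros Hx Hy. apply powS_spec. intros z Hz.
  unfold opr in Hz. apply upair_spec in Hz. apply powS_spec.
  destruct Hz as [-> | ->]; intros u Hu; apply upair_spec in Hu;
    destruct Hu as [-> | ->]; assumption.
Qed.

Lemma prod_exists A B :
  exists P, forall p, p ∈ P <-> exists a b, a ∈ A /\ b ∈ B /\ is_opair p a b.
Proof.
  destruct (separation (fun p => exists a b, a ∈ A /\ b ∈ B /\ is_opair p a b)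
    (powS (powS (cup A B)))) as [P HP]; [def|].
  exists P. intros p. rewrite HP. split; [tauto|]. intros H; split; [|exact H].
  destruct H as [a [b [Ha [Hb Hp]]]]. apply is_opair_iff in Hp; subst p.
  apply opr_in_pow; apply cup_spec; auto.
Qed.

Definition prodS A B : M := the _ (prod_exists A B).

Lemma prodS_spec A B p :
  p ∈ prodS A B <-> exists a b, a ∈ A /\ b ∈ B /\ p = opr a b.
Proof.
  unfold prodS. rewrite (the_spec _ (prod_exists A B) p).
  split; intros [a [b [Ha [Hb Hp]]]]; exists a, b;
    (split; [exact Ha|split; [exact Hb|apply is_opair_iff, Hp]]).
Qed.

Lemma prodS_opr A B a b : opr a b ∈ prodS A B <-> a ∈ A /\ b ∈ B.
Proof.
  rewrite prodS_spec. split.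
  - intros [a' [b' [Ha [Hb He]]]]. apply opr_inj in He.
    destruct He; subst; auto.
  - intros [Ha Hb]. exists a, b; auto.
Qed.

(** Comprehension for relations. The second conjunct excludes elements that are not pairs, as
    [partial_function] requires. *)
Lemma relation_exists (P : M -> M -> Prop) A B :
  Def2 P -> exists r, (forall a b, rel r a b <-> a ∈ A /\ b ∈ B /\ P a b) /\
    (forall p, p ∈ r -> exists a b, a ∈ A /\ b ∈ B /\ is_opair p a b).
Proof.
  intros HP.
  destruct (separation (fun p => exists a b, is_opair p a b /\ P a b) (prodS A B))
    as [r Hr].
  { apply Def_ex, Def_ex, Def_and; [def|].
    (* Under the quantifiers over [a] and then [b], variable 0 is [b] and variable 1 is [a]; the
       renaming swaps them back. *)
    exact (Def_ren _ (fun n => match n with 0 => 1 | _ => 0 end) HP). }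
  exists r. split.
  - intros a b. rewrite rel_iff, Hr, prodS_opr. split.
    + intros [[Ha Hb] [a' [b' [He H]]]]. apply is_opair_iff, opr_inj in He.
      destruct He; subst; auto.
    + intros [Ha [Hb H]]. split; [auto|]. exists a, b.
      split; [apply is_opair_iff; reflexivity|exact H].
  - intros p Hp. apply Hr, proj1, prodS_spec in Hp.
    destruct Hp as [a [b [Ha [Hb He]]]]. exists a, b.
    split; [exact Ha|split; [exact Hb|apply is_opair_iff, He]].
Qed.

Lemma rel_partial_function f A B a b :
  partial_function f A B -> rel f a b -> a ∈ A /\ b ∈ B.
Proof.
  intros [Hf _] H. apply rel_iff in H. destruct (Hf _ H) as [a' [b' [Ha [Hb He]]]].
  apply is_opair_iff, opr_inj in He. destruct He; subst; auto.
Qed.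

Lemma partial_function_subset f A B : partial_function f A B -> subset f (prodS A B).
Proof.
  intros [Hf _] p Hp. destruct (Hf _ Hp) as [a [b [Ha [Hb He]]]].
  apply is_opair_iff in He; subst. apply prodS_opr; auto.
Qed.

Lemma functions_exist A B : exists W, forall f, f ∈ W <-> total_function f A B.
Proof.
  destruct (separation (fun f => total_function f A B) (powS (prodS A B))) as [W HW];
    [def|].
  exists W. intros f. rewrite HW. split; [tauto|]. intros H; split; [|exact H].
  apply powS_spec, partial_function_subset, H.
Qed.

Definition funS A B : M := the _ (functions_exist A B).

Lemma funS_spec A B f : f ∈ funS A B <-> total_function f A B.
Proof. exact (the_spec _ (functions_exist A B) f). Qed.

Lemma update_exists s w A i x :
  total_function s w A -> i ∈ w -> x ∈ A ->
  exists s', total_function s' w A /\ rel s' i x /\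
    forall j y, j <> i -> (rel s' j y <-> rel s j y).
Proof.
  intros Hs Hi Hx.
  destruct (relation_exists (fun j y => (j = i /\ y = x) \/ (j <> i /\ rel s j y)) w A)
    as [s' [H1 H2]]; [def|].
  exists s'. split; [split; [split|]|split].
  - exact H2.
  - intros a b b' Hb Hb'. apply H1 in Hb, Hb'.
    destruct Hb as [_ [_ Hb]], Hb' as [_ [_ Hb']].
    destruct Hb as [[-> ->]|[Hn Hb]], Hb' as [[He ->]|[Hn' Hb']]; auto;
      try contradiction; try (exfalso; apply Hn, He).
    apply (proj2 (proj1 Hs) a); assumption.
  - intros j Hj. destruct (classic (j = i)) as [->|Hn].
    + exists x. apply H1; auto.
    + destruct (proj2 Hs j Hj) as [y Hy]. exists y. apply H1.
      destruct (rel_partial_function _ _ _ _ _ (proj1 Hs) Hy). auto.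
  - apply H1; auto.
  - intros j y Hn. rewrite H1. split.
    + intros [_ [_ [[He _]|[_ H]]]]; [contradiction|exact H].
    + intros H. destruct (rel_partial_function _ _ _ _ _ (proj1 Hs) H). auto.
Qed.

(** ** Ordinals *)

Lemma foundation_min (P : M -> Prop) a x :
  Def1 P -> x ∈ a -> P x ->
  exists y, y ∈ a /\ P y /\ forall z, z ∈ y -> z ∈ a -> ~ P z.
Proof.
  intros HP Hx HPx. destruct (separation P a HP) as [b Hb].
  destruct (zf_foundation M HZ b) as [y [Hy Hm]].
  - exists x. apply Hb; auto.
  - exists y. apply Hb in Hy. destruct Hy as [Hy HPy].
    split; [exact Hy|split; [exact HPy|]].
    intros z Hz Hza HPz. apply (Hm z Hz), Hb; auto.
Qed.

Lemma mem_irrefl x : ~ x ∈ x.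
Proof.
  intros H. destruct (zf_foundation M HZ (upair x x)) as [y [Hy Hm]].
  - exists x. apply upair_spec; auto.
  - apply upair_spec in Hy. assert (y = x) by tauto. subst.
    apply (Hm x H), upair_spec; auto.
Qed.

Lemma mem_asym x y : x ∈ y -> ~ y ∈ x.
Proof.
  intros H H'. destruct (zf_foundation M HZ (upair x y)) as [z [Hz Hm]].
  - exists x. apply upair_spec; auto.
  - apply upair_spec in Hz. destruct Hz as [-> | ->].
    + apply (Hm y H'), upair_spec; auto.
    + apply (Hm x H), upair_spec; auto.
Qed.

Lemma ordinal_mem a b : ordinal a -> b ∈ a -> ordinal b.
Proof.
  intros [Ht Hl] Hb. split.
  - intros y Hy z Hz.
    assert (Hya : y ∈ a) by (apply (Ht b Hb); exact Hy).
    assert (Hza : z ∈ a) by (apply (Ht y Hya); exact Hz).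
    destruct (Hl z b Hza Hb) as [H|[H|H]]; [exact H| |].
    + subst z. destruct (mem_asym _ _ Hy Hz).
    (* The cycle [b ∈ z ∈ y ∈ b] contradicts foundation for the set of its three members. *)
    + destruct (zf_foundation M HZ (cup (upair z y) (upair b b))) as [u [Hu Hm]].
      * exists b. rewrite cup_spec, !upair_spec; auto.
      * rewrite cup_spec, !upair_spec in Hu.
        destruct Hu as [[-> | ->]|[-> | ->]].
        -- destruct (Hm b H). rewrite cup_spec, !upair_spec; auto.
        -- destruct (Hm z Hz). rewrite cup_spec, !upair_spec; auto.
        -- destruct (Hm y Hy). rewrite cup_spec, !upair_spec; auto.
        -- destruct (Hm y Hy). rewrite cup_spec, !upair_spec; auto.
  - intros y z Hy Hz. apply Hl; apply (Ht b Hb); assumption.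
Qed.

Lemma ordinal_trans a b c : ordinal a -> b ∈ a -> c ∈ b -> c ∈ a.
Proof. intros [Ht _] Hb Hc. exact (Ht b Hb c Hc). Qed.

(** If [c] misses an element of [a], then it equals the least element it misses. *)
Lemma transitive_subset_ordinal a c :
  ordinal a -> transitive_set c -> subset c a -> c = a \/ c ∈ a.
Proof.
  intros Ha Hc Hs. destruct (classic (exists x, x ∈ a /\ ~ x ∈ c)) as [[x [Hx Hn]]|H].
  - right. destruct (foundation_min (fun x => ~ x ∈ c) a x) as [m [Hma [Hmc Hm]]];
      [def|exact Hx|exact Hn|].
    replace c with m; [exact Hma|]. apply set_ext; intros z. split; intros Hz.
    + apply NNPP. apply Hm; [exact Hz|]. exact (ordinal_trans a m z Ha Hma Hz).
    + destruct (proj2 Ha m z Hma (Hs z Hz)) as [H|[H|H]]; [| |exact H].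
      * destruct Hmc. exact (Hc z Hz m H).
      * subst; contradiction.
  - left. apply subset_antisym; [exact Hs|]. intros x Hx.
    apply NNPP; intros Hn; apply H; exists x; auto.
Qed.

(** The intersection [c] of [a] and [b] is transitive, so it equals or belongs to each of them. If
    it belonged to both, it would belong to itself. *)
Lemma ordinal_trichotomy a b : ordinal a -> ordinal b -> a ∈ b \/ a = b \/ b ∈ a.
Proof.
  intros Ha Hb.
  destruct (separation (fun x => x ∈ b) a) as [c Hc]; [def|].
  assert (Htc : transitive_set c).
  { intros y Hy z Hz. apply Hc in Hy. apply Hc. destruct Hy.
    split; [apply (ordinal_trans a y)|apply (ordinal_trans b y)]; assumption. }
  destruct (transitive_subset_ordinal a c Ha Htc) as [H|H].
  { intros z Hz; apply Hc, Hz. }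
  - destruct (transitive_subset_ordinal b c Hb Htc) as [H'|H'].
    { intros z Hz; apply Hc, Hz. }
    + subst; auto.
    + subst; auto.
  - destruct (transitive_subset_ordinal b c Hb Htc) as [H'|H'].
    { intros z Hz; apply Hc, Hz. }
    + subst; auto.
    + destruct (mem_irrefl c). apply Hc; auto.
Qed.

Lemma ordinal_not_mem a b : ordinal a -> ordinal b -> ~ a ∈ b -> subset b a.
Proof.
  intros Ha Hb Hn. destruct (ordinal_trichotomy a b Ha Hb) as [H|[H|H]].
  - contradiction.
  - subst; apply subset_refl.
  - apply Ha, H.
Qed.

Lemma ordinal_succS a : ordinal a -> ordinal (succS a).
Proof.
  intros Ha. split.
  - intros y Hy z Hz. apply succS_spec. apply succS_spec in Hy.
    left. destruct Hy as [Hy| ->]; [exact (ordinal_trans a y z Ha Hy Hz)|exact Hz].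
  - intros y z Hy Hz. apply succS_spec in Hy, Hz.
    destruct Hy as [Hy| ->], Hz as [Hz| ->]; auto. apply Ha; assumption.
Qed.

Lemma ordinal_emp : ordinal emp.
Proof.
  split; [intros y Hy|intros y z Hy]; destruct (emp_spec _ Hy).
Qed.

Lemma ordinal_max a b : ordinal a -> ordinal b ->
  exists c, ordinal c /\ ord_le a c /\ ord_le b c /\ (c = a \/ c = b).
Proof.
  intros Ha Hb. unfold ord_le.
  destruct (ordinal_trichotomy a b Ha Hb) as [H|[H|H]];
    [exists b|exists b|exists a]; subst; auto 10.
Qed.

Lemma ordinal_le_trans a b c : ordinal c -> ord_le a b -> b ∈ c -> a ∈ c.
Proof.
  intros Hc [H| ->] Hb; [exact (ordinal_trans c b a Hc Hb H)|exact Hb].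
Qed.

Lemma ordinal_mem_le a b c : ordinal c -> a ∈ b -> ord_le b c -> a ∈ c.
Proof.
  intros Hc H [Hb| <-]; [exact (ordinal_trans c b a Hc Hb H)|exact H].
Qed.

Lemma ordinal_least (P : M -> Prop) a :
  Def1 P -> ordinal a -> P a ->
  exists b, ordinal b /\ P b /\ forall c, c ∈ b -> ~ P c.
Proof.
  intros HP Ha HPa.
  destruct (foundation_min P (succS a) a) as [b [Hb [HPb Hm]]];
    [exact HP|apply succS_spec; auto|exact HPa|].
  assert (Hob : ordinal b) by (apply (ordinal_mem (succS a)); [apply ordinal_succS|]; auto).
  exists b. split; [exact Hob|split; [exact HPb|]].
  intros c Hc. apply Hm; [exact Hc|].
  apply (ordinal_trans (succS a) b); [apply ordinal_succS| |]; assumption.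
Qed.

Lemma ordinal_ind (P : M -> Prop) :
  Def1 P -> (forall a, ordinal a -> (forall b, b ∈ a -> P b) -> P a) ->
  forall a, ordinal a -> P a.
Proof.
  intros HP IH a Ha. apply NNPP; intros Hn.
  destruct (ordinal_least (fun x => ~ P x) a) as [b [Hb [HPb Hm]]];
    [apply Def_not, HP|exact Ha|exact Hn|].
  apply HPb, IH; [exact Hb|]. intros c Hc. apply NNPP, Hm, Hc.
Qed.

(** ** The natural numbers *)

Lemma omega_exists : exists w, is_omega w.
Proof.
  destruct (zf_infinity M HZ) as [w Hw].
  destruct (separation (fun x => forall v, inductive_set v -> x ∈ v) w) as [o Ho]; [def|].
  exists o. split; [split|].
  - exists emp. split; [exact emp_spec|]. apply Ho.
    assert (H : forall v, inductive_set v -> emp ∈ v).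
    { intros v [[z [Hz Hv]] _]. apply is_empty_iff in Hz; subst; exact Hv. }
    auto.
  - intros x Hx. apply Ho in Hx. destruct Hx as [_ Hx].
    exists (succS x). split; [apply is_succ_iff; reflexivity|].
    assert (H : forall v, inductive_set v -> succS x ∈ v).
    { intros v Hv. destruct (proj2 Hv x (Hx v Hv)) as [y [Hy Hyv]].
      apply is_succ_iff in Hy; subst; exact Hyv. }
    apply Ho; auto.
  - intros v Hv x Hx. apply Ho in Hx. apply Hx, Hv.
Qed.

Definition omg : M := the _ omega_exists.

Lemma is_omega_omg : is_omega omg.
Proof. exact (the_spec _ omega_exists). Qed.

Lemma is_omega_iff w : is_omega w <-> w = omg.
Proof.
  split; [|intros ->; exact is_omega_omg].
  intros [Hw Hm]. destruct is_omega_omg as [Ho Hmo]. apply subset_antisym; auto.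
Qed.

Lemma emp_omg : emp ∈ omg.
Proof.
  destruct is_omega_omg as [[[o [Ho H]] _] _]. apply is_empty_iff in Ho; subst; exact H.
Qed.

Lemma succS_omg n : n ∈ omg -> succS n ∈ omg.
Proof.
  intros Hn. destruct is_omega_omg as [[_ H] _]. destruct (H n Hn) as [y [Hy Hyo]].
  apply is_succ_iff in Hy; subst; exact Hyo.
Qed.

Lemma omega_ind (P : M -> Prop) :
  Def1 P -> P emp -> (forall n, n ∈ omg -> P n -> P (succS n)) ->
  forall n, n ∈ omg -> P n.
Proof.
  intros HP H0 HS. destruct (separation P omg HP) as [v Hv].
  assert (Hi : inductive_set v).
  { split.
    - exists emp. split; [exact emp_spec|]. apply Hv. split; [exact emp_omg|exact H0].
    - intros x Hx. apply Hv in Hx. destruct Hx as [Hx HPx].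
      exists (succS x). split; [apply is_succ_iff; reflexivity|].
      apply Hv. split; [apply succS_omg, Hx|apply HS; assumption]. }
  intros n Hn. apply Hv. exact (proj2 is_omega_omg v Hi n Hn).
Qed.

Lemma ordinal_nat n : n ∈ omg -> ordinal n.
Proof.
  revert n. apply omega_ind; [def|exact ordinal_emp|].
  intros n _. apply ordinal_succS.
Qed.

Lemma ordinal_omg : ordinal omg.
Proof.
  split.
  - intros y Hy. revert y Hy. apply omega_ind; [def| |].
    + intros z Hz; destruct (emp_spec z Hz).
    + intros n Hn IH z Hz. apply succS_spec in Hz. destruct Hz as [Hz| ->]; auto.
  - intros y z Hy Hz. apply ordinal_trichotomy; apply ordinal_nat; assumption.
Qed.

Fixpoint num (n : nat) : M :=
  match n with 0 => emp | S m => succS (num m) end.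

Lemma is_num_iff n x : is_num n x <-> x = num n.
Proof.
  revert x; induction n as [|n IH]; intros x; simpl.
  - apply is_empty_iff.
  - split.
    + intros [y [Hy Hx]]. apply IH in Hy; subst. apply is_succ_iff, Hx.
    + intros ->. exists (num n). split; [apply IH|apply is_succ_iff]; reflexivity.
Qed.

Lemma num_omg n : num n ∈ omg.
Proof. induction n; simpl; [exact emp_omg|apply succS_omg; assumption]. Qed.

Lemma num_lt m n : m < n -> num m ∈ num n.
Proof.
  induction 1; simpl; apply succS_spec; auto.
Qed.

Lemma num_inj m n : num m = num n -> m = n.
Proof.
  intros H. destruct (Nat.lt_total m n) as [Hl|[Hl|Hl]]; [|exact Hl|];
    apply num_lt in Hl; rewrite H in Hl; destruct (mem_irrefl _ Hl).
Qed.

(** The variables [rho n] may be nonstandard, but only finitely many count, so an external induction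
    on [N] finds a strict upper bound for them. *)
Lemma fresh_nat (rho : nat -> M) N :
  (forall n, rho n ∈ omg) -> exists k, k ∈ omg /\ forall n, n < N -> k <> rho n.
Proof.
  intros Hr.
  assert (H : exists k, k ∈ omg /\ forall n, n < N -> rho n ∈ k).
  { induction N as [|N [k [Hk IH]]].
    - exists emp. split; [exact emp_omg|]. intros n Hn; lia.
    - destruct (ordinal_max k (rho N)) as [m [Hm [H1 [H2 H3]]]];
        try (apply ordinal_nat; auto; fail).
      exists (succS m). split.
      + apply succS_omg. destruct H3 as [-> | ->]; auto.
      + intros n Hn. assert (Hs := ordinal_succS m Hm).
        destruct (Nat.eq_dec n N) as [->|Hne].
        * apply succS_spec. destruct H2 as [H2|H2]; auto.
        * apply (ordinal_trans _ k); [exact Hs| |apply IH; lia].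
          apply succS_spec. destruct H1 as [H1|H1]; auto.
          }
  destruct H as [k [Hk H]]. exists k. split; [exact Hk|].
  intros n Hn ->. exact (mem_irrefl _ (H n Hn)).
Qed.

End SetTheory.

(** * The cumulative hierarchy *)

Section Hierarchy.
Context {M : structure} {HZ : ZFC M}.
Implicit Types a b c d f g h k o p r s t u v w x y z A B C U : M.

Definition V_clause h : Prop :=
  forall b y, rel h b y ->
    forall z, z ∈ y <-> exists c x, c ∈ b /\ rel h c x /\ subset z x.

Lemma V_clause_agree h h' d d' B B' :
  ordinal d -> ordinal d' -> total_function h d B -> total_function h' d' B' ->
  V_clause h -> V_clause h' ->
  forall b, b ∈ d -> b ∈ d' -> forall y y', rel h b y -> rel h' b y' -> y = y'.
Proof.
  intros Hd Hd' Hh Hh' Hc Hc' b Hb. assert (Hob := ordinal_mem d b Hd Hb).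
  revert b Hob Hb.
  apply (ordinal_ind (fun b => b ∈ d -> b ∈ d' ->
    forall y y', rel h b y -> rel h' b y' -> y = y')); [def|].
  intros b Hob IH Hb Hb' y y' Hy Hy'. apply set_ext; intros z.
  rewrite (Hc b y Hy), (Hc' b y' Hy').
  split; intros [c [x [Hcb [Hx Hz]]]].
  - assert (Hcd' := ordinal_trans d' b c Hd' Hb' Hcb).
    destruct (proj2 Hh' c Hcd') as [x' Hx']. exists c, x'.
    rewrite <- (IH c Hcb (ordinal_trans d b c Hd Hb Hcb) Hcd' x x' Hx Hx').
    rewrite (IH c Hcb (ordinal_trans d b c Hd Hb Hcb) Hcd' x x' Hx Hx') at 1. auto.
  - assert (Hcd := ordinal_trans d b c Hd Hb Hcb).
    destruct (proj2 Hh c Hcd) as [x' Hx']. exists c, x'.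
    rewrite (IH c Hcb Hcd (ordinal_trans d' b c Hd' Hb' Hcb) x' x Hx' Hx).
    rewrite <- (IH c Hcb Hcd (ordinal_trans d' b c Hd' Hb' Hcb) x' x Hx' Hx) at 1. auto.
Qed.

Lemma is_V_ordinal a v : is_V a v -> ordinal a.
Proof. intros [H _]; exact H. Qed.

Lemma is_V_unique a v v' : is_V a v -> is_V a v' -> v = v'.
Proof.
  intros [Ha [h [d [B [Hd [Hh [Hc Hv]]]]]]] [_ [h' [d' [B' [Hd' [Hh' [Hc' Hv']]]]]]].
  apply is_succ_iff in Hd, Hd'; subst d d'.
  assert (Hs := ordinal_succS a Ha).
  apply (V_clause_agree h h' (succS a) (succS a) B B' Hs Hs Hh Hh' Hc Hc' a);
    try assumption; apply succS_spec; auto.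
Qed.

(** The restriction of [h] to [c + 1] is itself a computation of the level [c]. *)
Lemma V_clause_is_V a h B c x :
  ordinal a -> total_function h (succS a) B -> V_clause h -> rel h c x -> is_V c x.
Proof.
  intros Ha Hh Hc Hx.
  destruct (rel_partial_function _ _ _ _ _ (proj1 Hh) Hx) as [Hca HxB].
  assert (Hs := ordinal_succS a Ha). assert (Hoc := ordinal_mem _ c Hs Hca).
  assert (Hsub : subset (succS c) (succS a)).
  { intros z Hz. apply succS_spec in Hz. destruct Hz as [Hz| ->]; [|exact Hca].
    exact (ordinal_trans _ c z Hs Hca Hz). }
  split; [exact Hoc|].
  destruct (relation_exists (rel h) (succS c) B) as [h' [H1 H2]]; [def|].
  exists h', (succS c), B. split; [apply is_succ_iff; reflexivity|].
  split; [split; [split|]|split].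
  - exact H2.
  - intros b y y' Hy Hy'. apply H1 in Hy, Hy'.
    apply (proj2 (proj1 Hh) b); [apply Hy|apply Hy'].
  - intros b Hb. destruct (proj2 Hh b (Hsub b Hb)) as [y Hy]. exists y.
    apply H1. destruct (rel_partial_function _ _ _ _ _ (proj1 Hh) Hy). auto.
  - intros b y Hy. apply H1 in Hy. destruct Hy as [Hb [HyB Hy]].
    intros z. rewrite (Hc b y Hy).
    split; intros [c' [x' [Hc' [Hx' Hz]]]]; exists c', x';
      (split; [exact Hc'|split; [|exact Hz]]).
    + apply H1. split; [|split; [|exact Hx']].
      * exact (ordinal_trans _ b c' (ordinal_succS c Hoc) Hb Hc').
      * apply (rel_partial_function _ _ _ _ _ (proj1 Hh) Hx').
    + apply H1 in Hx'. apply Hx'.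
  - apply H1. split; [apply succS_spec; auto|auto].
Qed.

(** Frees the recursion from its witness [h]: the values of [h] are levels, and by uniqueness a
    level below [a] is the value of [h] there. *)
Lemma is_V_spec a v :
  is_V a v -> forall z, z ∈ v <-> exists c x, c ∈ a /\ is_V c x /\ subset z x.
Proof.
  intros [Ha [h [d [B [Hd [Hh [Hc Hv]]]]]]] z.
  apply is_succ_iff in Hd; subst d. rewrite (Hc a v Hv).
  split; intros [c [x [Hca [Hx Hz]]]]; exists c, x;
    (split; [exact Hca|split; [|exact Hz]]).
  - exact (V_clause_is_V a h B c x Ha Hh Hc Hx).
  - destruct (proj2 Hh c) as [x' Hx']; [apply succS_spec; auto|].
    rewrite (is_V_unique c x x'); [exact Hx'|exact Hx|].
    exact (V_clause_is_V a h B c x' Ha Hh Hc Hx').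
Qed.

(** Replacement gathers the earlier levels into [R]. Every subset of one of them is a subset of the
    union of [R], so separation yields the next level, and [h] is extended by it at [a]. *)
Lemma is_V_exists a : ordinal a -> exists v, is_V a v.
Proof.
  revert a. apply ordinal_ind; [def|]. intros a Ha IH.
  destruct (replacement (fun c x => is_V c x) a) as [R HR]; [def| |].
  { intros c Hc. destruct (IH c Hc) as [x Hx]. exists x. split; [exact Hx|].
    intros x' Hx'. exact (is_V_unique c x x' Hx Hx'). }
  destruct (separation (fun z => exists c x, c ∈ a /\ is_V c x /\ subset z x)
    (powS (unionS R))) as [v Hv]; [def|].
  assert (Hv' : forall z, z ∈ v <-> exists c x, c ∈ a /\ is_V c x /\ subset z x).
  { intros z. rewrite Hv. split; [tauto|]. intros H; split; [|exact H].
    destruct H as [c [x [Hc [Hx Hz]]]]. apply powS_spec. intros y Hy.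
    apply unionS_spec. exists x. split; [apply HR; exists c; auto|auto]. }
  destruct (relation_exists (fun b y => (b ∈ a /\ is_V b y) \/ (b = a /\ y = v))
    (succS a) (cup R (upair v v))) as [h [H1 H2]]; [def|].
  assert (H3 : forall b y, rel h b y <-> (b ∈ a /\ is_V b y) \/ (b = a /\ y = v)).
  { intros b y. rewrite H1. split; [tauto|]. intros H. rewrite succS_spec, cup_spec,
      upair_spec. split; [tauto|split; [|exact H]].
    destruct H as [H|H]; [left; apply HR; exists b; exact H|tauto]. }
  exists v. split; [exact Ha|].
  exists h, (succS a), (cup R (upair v v)).
  split; [apply is_succ_iff; reflexivity|].
  split; [split; [split|]|split].
  - exact H2.
  - intros b y y' Hy Hy'. apply H3 in Hy, Hy'.
    destruct Hy as [[Hb Hy]|[Hb Hy]], Hy' as [[Hb' Hy']|[Hb' Hy']]; subst; auto.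
    + exact (is_V_unique b y y' Hy Hy').
    + destruct (mem_irrefl a Hb).
    + destruct (mem_irrefl a Hb').
  - intros b Hb. apply succS_spec in Hb. destruct Hb as [Hb| ->].
    + destruct (IH b Hb) as [y Hy]. exists y. apply H3; auto.
    + exists v. apply H3; auto.
  - intros b y Hy z. apply H3 in Hy.
    assert (E : z ∈ y <-> exists c x, c ∈ b /\ is_V c x /\ subset z x).
    { destruct Hy as [[Hb Hy]|[-> ->]]; [apply is_V_spec, Hy|apply Hv']. }
    rewrite E. split; intros [c [x [Hc [Hx Hz]]]]; exists c, x;
      (split; [exact Hc|split; [|exact Hz]]).
    + apply H3. left. split; [|exact Hx].
      destruct Hy as [[Hb Hy]|[-> ->]]; [exact (ordinal_trans a b c Ha Hb Hc)|exact Hc].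
    + apply H3 in Hx. destruct Hx as [[_ Hx]|[-> ->]]; [exact Hx|].
      destruct Hy as [[Hb Hy]|[-> ->]]; [destruct (mem_asym _ _ Hb Hc)|].
      destruct (mem_irrefl _ Hc).
  - apply H3; auto.
Qed.

Lemma V_transitive a v : is_V a v -> transitive_set v.
Proof.
  intros Hv y Hy z Hz. assert (Ha := is_V_ordinal a v Hv).
  apply (is_V_spec a v Hv) in Hy. destruct Hy as [c [x [Hc [Hx Hy]]]].
  apply Hy in Hz. apply (is_V_spec c x Hx) in Hz.
  destruct Hz as [c' [x' [Hc' [Hx' Hz]]]].
  apply (is_V_spec a v Hv). exists c', x'.
  split; [exact (ordinal_trans a c c' Ha Hc Hc')|auto].
Qed.

Lemma V_subset_closed a v x y : is_V a v -> x ∈ v -> subset y x -> y ∈ v.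
Proof.
  intros Hv Hx Hy. apply (is_V_spec a v Hv) in Hx. apply (is_V_spec a v Hv).
  destruct Hx as [c [u [Hc [Hu Hx]]]]. exists c, u.
  split; [exact Hc|split; [exact Hu|]]. intros z Hz; auto.
Qed.

Lemma V_mem a v b u : is_V a v -> is_V b u -> b ∈ a -> u ∈ v.
Proof.
  intros Hv Hu Hb. apply (is_V_spec a v Hv). exists b, u.
  split; [exact Hb|split; [exact Hu|apply subset_refl]].
Qed.

Lemma V_mono a v b u : is_V a v -> is_V b u -> ord_le b a -> subset u v.
Proof.
  intros Hv Hu [Hb| ->].
  - apply (V_transitive a v Hv). exact (V_mem a v b u Hv Hu Hb).
  - rewrite (is_V_unique a u v Hu Hv). apply subset_refl.
Qed.

Lemma ordinal_subset_V a v : is_V a v -> subset a v.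
Proof.
  intros Hv. assert (Ha := is_V_ordinal a v Hv). revert v Hv. revert a Ha.
  apply (ordinal_ind (fun a => forall v, is_V a v -> subset a v)); [def|].
  intros a Ha IH v Hv b Hb.
  destruct (is_V_exists b (ordinal_mem a b Ha Hb)) as [u Hu].
  apply (is_V_spec a v Hv). exists b, u. auto.
Qed.

(** If [x ∈ v] were an ordinal not below [a], then [x] would include [a] while being a subset of
    some earlier level V_c. Then [c] would be an element of V_c, and the induction hypothesis would
    give [c ∈ c]. *)
Lemma V_ordinals a v x : is_V a v -> ordinal x -> (x ∈ v <-> x ∈ a).
Proof.
  intros Hv Hx. split; [|apply (ordinal_subset_V a v Hv)].
  assert (Ha := is_V_ordinal a v Hv). revert v Hv x Hx. revert a Ha.
  apply (ordinal_ind (fun a => forall v, is_V a v -> forall x, ordinal x ->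
    x ∈ v -> x ∈ a)); [def|].
  intros a Ha IH v Hv x Hx H. apply (is_V_spec a v Hv) in H.
  destruct H as [c [u [Hc [Hu Hxu]]]].
  apply NNPP; intros Hn.
  assert (Hcx : c ∈ x) by (apply (ordinal_not_mem x a Hx Ha Hn), Hc).
  apply (mem_irrefl c). apply (IH c Hc u Hu c); [exact (ordinal_mem a c Ha Hc)|].
  apply Hxu, Hcx.
Qed.

(** * Universes closed under subsets and power sets *)

Definition limit a : Prop := ordinal a /\ forall b, b ∈ a -> succS b ∈ a.

(** The features of a limit level on which absoluteness rests. [cu_bound] stands in for pairing and
    binary union: singletons are subsets of power sets, and a common superset of two singletons
    includes the pair. *)
Record closed_universe U : Prop := {
  cu_trans : forall x y, x ∈ U -> y ∈ x -> y ∈ U;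
  cu_subset : forall x y, x ∈ U -> subset y x -> y ∈ U;
  cu_pow : forall x, x ∈ U -> powS x ∈ U;
  cu_bound : forall x y, x ∈ U -> y ∈ U ->
    exists z, z ∈ U /\ subset x z /\ subset y z }.

Lemma V_limit_closed a v : limit a -> is_V a v -> closed_universe v.
Proof.
  intros [Ha Hl] Hv. split.
  - intros x y Hx Hy. exact (V_transitive a v Hv x Hx y Hy).
  - intros x y. apply (V_subset_closed a v x y Hv).
  - intros x Hx. apply (is_V_spec a v Hv) in Hx. apply (is_V_spec a v Hv).
    destruct Hx as [c [u [Hc [Hu Hx]]]].
    assert (Hoc := ordinal_mem a c Ha Hc).
    destruct (is_V_exists (succS c) (ordinal_succS c Hoc)) as [u' Hu'].
    exists (succS c), u'. split; [apply Hl, Hc|split; [exact Hu'|]].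
    intros z Hz. apply powS_spec in Hz. apply (is_V_spec _ u' Hu').
    exists c, u. split; [apply succS_spec; auto|split; [exact Hu|]].
    intros y Hy; apply Hx, Hz, Hy.
  - intros x y Hx Hy. apply (is_V_spec a v Hv) in Hx, Hy.
    destruct Hx as [c [u [Hc [Hu Hx]]]], Hy as [c' [u' [Hc' [Hu' Hy]]]].
    destruct (ordinal_max c c') as [m [Hm [H1 [H2 H3]]]];
      [exact (ordinal_mem a c Ha Hc)|exact (ordinal_mem a c' Ha Hc')|].
    destruct (is_V_exists m Hm) as [q Hq]. exists q. split.
    + apply (V_mem a v m q Hv Hq). destruct H3; subst; assumption.
    + split; intros z Hz.
      * apply (V_mono m q c u Hq Hu H1), Hx, Hz.
      * apply (V_mono m q c' u' Hq Hu' H2), Hy, Hz.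
Qed.

Section ClosedUniverse.
Context (U : M) (HU : closed_universe U).

Lemma cu_upair x y : x ∈ U -> y ∈ U -> upair x y ∈ U.
Proof.
  assert (Hs : forall x, x ∈ U -> upair x x ∈ U).
  { intros u Hu. apply (cu_subset U HU (powS u)); [apply (cu_pow U HU), Hu|].
    intros z Hz. apply upair_spec in Hz. apply powS_spec.
    destruct Hz as [-> | ->]; apply subset_refl. }
  intros Hx Hy.
  destruct (cu_bound U HU _ _ (Hs x Hx) (Hs y Hy)) as [z [Hz [H1 H2]]].
  apply (cu_subset U HU z); [exact Hz|]. intros u Hu. apply upair_spec in Hu.
  destruct Hu as [-> | ->]; [apply H1|apply H2]; apply upair_spec; auto.
Qed.

Lemma cu_opr x y : x ∈ U -> y ∈ U -> opr x y ∈ U.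
Proof. intros Hx Hy. unfold opr. apply cu_upair; apply cu_upair; assumption. Qed.

Lemma cu_opr_inv x y : opr x y ∈ U -> x ∈ U /\ y ∈ U.
Proof.
  intros H. assert (H' : upair x y ∈ U).
  { apply (cu_trans U HU (opr x y)); [exact H|]. unfold opr. apply upair_spec; auto. }
  split; apply (cu_trans U HU (upair x y)); auto; apply upair_spec; auto.
Qed.

Lemma cu_cup x y : x ∈ U -> y ∈ U -> cup x y ∈ U.
Proof.
  intros Hx Hy. destruct (cu_bound U HU x y Hx Hy) as [z [Hz [H1 H2]]].
  apply (cu_subset U HU z); [exact Hz|]. intros u Hu. apply cup_spec in Hu.
  destruct Hu; auto.
Qed.

Lemma cu_succS x : x ∈ U -> succS x ∈ U.
Proof. intros Hx. unfold succS. apply cu_cup; [exact Hx|apply cu_upair; exact Hx]. Qed.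

Lemma cu_prodS A B : A ∈ U -> B ∈ U -> prodS A B ∈ U.
Proof.
  intros HA HB. apply (cu_subset U HU (powS (powS (cup A B)))).
  - apply (cu_pow U HU), (cu_pow U HU), cu_cup; assumption.
  - intros p Hp. apply prodS_spec in Hp. destruct Hp as [a [b [Ha [Hb ->]]]].
    apply opr_in_pow; apply cup_spec; auto.
Qed.

Lemma cu_partial_function f A B : A ∈ U -> B ∈ U -> partial_function f A B -> f ∈ U.
Proof.
  intros HA HB Hf. apply (cu_subset U HU (prodS A B)); [apply cu_prodS; assumption|].
  apply partial_function_subset, Hf.
Qed.

Lemma cu_num n : emp ∈ U -> num n ∈ U.
Proof. intros H. induction n; simpl; [exact H|apply cu_succS; assumption]. Qed.

End ClosedUniverse.

Lemma limit_omg : limit omg.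
Proof. split; [exact ordinal_omg|exact succS_omg]. Qed.

Lemma inaccessible_ordinal k : inaccessible k -> ordinal k.
Proof. intros [[H _] _]; exact H. Qed.

Lemma inaccessible_omg k : inaccessible k -> omg ∈ k.
Proof. intros [_ [[w [Hw H]] _]]. apply is_omega_iff in Hw; subst; exact H. Qed.

(* If [k = b + 1], the function [0 |-> b] on 1 is unbounded in [k]. *)
Lemma inaccessible_limit k : inaccessible k -> limit k.
Proof.
  intros Hk. assert (Ho := inaccessible_ordinal k Hk). split; [exact Ho|].
  intros b Hb.
  destruct (transitive_subset_ordinal k (succS b) Ho) as [He|H]; [| | |exact H].
  - apply ordinal_succS, (ordinal_mem k b Ho Hb).
  - intros z Hz. apply succS_spec in Hz. destruct Hz as [Hz| ->]; [|exact Hb].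
    exact (ordinal_trans k b z Ho Hb Hz).
  - exfalso.
    assert (H1 : num 1 ∈ k).
    { apply (ordinal_trans k omg); [exact Ho|exact (inaccessible_omg k Hk)|].
      apply num_omg. }
    destruct (relation_exists (fun _ y => y = b) (num 1) k) as [g [Hg1 Hg2]]; [def|].
    destruct Hk as [_ [_ [Hr _]]].
    destruct (Hr (num 1) g H1) as [m [Hm Hb']].
    + split; [split|].
      * exact Hg2.
      * intros a y y' Hy Hy'. apply Hg1 in Hy, Hy'.
        destruct Hy as [_ [_ ->]], Hy' as [_ [_ ->]]. reflexivity.
      * intros a Ha. exists b. apply Hg1; auto.
    + assert (Hbm : b ∈ m).
      { apply (Hb' emp). apply Hg1. split; [apply (num_lt 0 1); lia|auto]. }
      rewrite <- He in Hm. apply succS_spec in Hm. destruct Hm as [Hm| ->].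
      * exact (mem_asym _ _ Hbm Hm).
      * exact (mem_irrefl _ Hbm).
Qed.

End Hierarchy.

(** * Coded formulas and truth *)

Section Formulas.
Context {M : structure} {HZ : ZFC M}.
Implicit Types a c d f g h k i j o p q r s t u v w x y z A B C F T U W X Y Z : M.

Definition mk1 n p : M := opr (num n) p.
Definition mk2 n x y : M := opr (num n) (opr x y).

Lemma tagged_iff n c x : tagged n c x <-> c = mk1 n x.
Proof.
  unfold tagged. split.
  - intros [t [Ht Hc]]. apply is_num_iff in Ht. apply is_opair_iff in Hc.
    subst; reflexivity.
  - intros ->. exists (num n). split; [apply is_num_iff|apply is_opair_iff]; reflexivity.
Qed.

Lemma tagged2_iff n c x y : tagged2 n c x y <-> c = mk2 n x y.
Proof.
  unfold tagged2. split.
  - intros [p [Hp Hc]]. apply is_opair_iff in Hp. apply tagged_iff in Hc.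
    subst; reflexivity.
  - intros ->. exists (opr x y). split; [apply is_opair_iff|apply tagged_iff]; reflexivity.
Qed.

Lemma formula_closed_iff b w C :
  formula_closed b w C <->
  (forall i j, i ∈ w -> j ∈ w -> mk2 0 i j ∈ C) /\
  (forall i j, i ∈ w -> j ∈ w -> mk2 1 i j ∈ C) /\
  (b = true -> forall i j, i ∈ w -> j ∈ w -> mk2 2 i j ∈ C) /\
  (forall p, p ∈ C -> mk1 3 p ∈ C) /\
  (forall p q, p ∈ C -> q ∈ C -> mk2 4 p q ∈ C) /\
  (forall i p, i ∈ w -> p ∈ C -> mk2 5 i p ∈ C).
Proof.
  unfold formula_closed, code_mem, code_eq, code_fun, code_neg, code_and, code_ex.
  split; intros [H1 [H2 [H3 [H4 [H5 H6]]]]]; repeat split.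
  - intros i j Hi Hj. apply (H1 _ i j); auto. apply tagged2_iff; reflexivity.
  - intros i j Hi Hj. apply (H2 _ i j); auto. apply tagged2_iff; reflexivity.
  - intros Hb i j Hi Hj. apply (H3 Hb _ i j); auto. apply tagged2_iff; reflexivity.
  - intros p Hp. apply (H4 _ p); auto. apply tagged_iff; reflexivity.
  - intros p q Hp Hq. apply (H5 _ p q); auto. apply tagged2_iff; reflexivity.
  - intros i p Hi Hp. apply (H6 _ i p); auto. apply tagged2_iff; reflexivity.
  - intros c i j Hi Hj Hc. apply tagged2_iff in Hc; subst; auto.
  - intros c i j Hi Hj Hc. apply tagged2_iff in Hc; subst; auto.
  - intros Hb c i j Hi Hj Hc. apply tagged2_iff in Hc; subst; auto.
  - intros c p Hp Hc. apply tagged_iff in Hc; subst; auto.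
  - intros c p q Hp Hq Hc. apply tagged2_iff in Hc; subst; auto.
  - intros c i p Hi Hp Hc. apply tagged2_iff in Hc; subst; auto.
Qed.

(** Applied to V_ω this gives one set closed under formula building, from which the least such set
    can be separated. *)
Lemma formula_closed_universe b U :
  closed_universe U -> subset omg U -> formula_closed b omg U.
Proof.
  intros HU Ho.
  assert (Hn : forall n, num n ∈ U) by (intros n; apply Ho, num_omg).
  apply formula_closed_iff. unfold mk1, mk2.
  repeat split; intros; repeat apply cu_opr; auto.
Qed.

Lemma formulas_exist b : exists F, is_formulas b F.
Proof.
  destruct (is_V_exists omg ordinal_omg) as [v Hv].
  assert (Hcl : formula_closed b omg v).
  { apply formula_closed_universe; [exact (V_limit_closed omg v limit_omg Hv)|].
    exact (ordinal_subset_V omg v Hv). }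
  destruct (separation (fun x => forall C, formula_closed b omg C -> x ∈ C) v)
    as [F HF]; [def|].
  assert (HF' : forall x, x ∈ F <-> forall C, formula_closed b omg C -> x ∈ C).
  { intros x. rewrite HF. split; [tauto|]. intros H; split; auto. }
  exists F, omg. split; [exact is_omega_omg|]. split.
  - apply formula_closed_iff.
    assert (H : forall C, formula_closed b omg C -> _)
      by (intros C HC; exact (proj1 (formula_closed_iff b omg C) HC)).
    repeat split; intros; apply HF'; intros C HC;
      destruct (H C HC) as [H1' [H2' [H3' [H4' [H5' H6']]]]];
      repeat match goal with K : _ ∈ F |- _ =>
        apply HF' with (C := C) in K; [|exact HC] end; auto.
  - intros C HC x Hx. apply HF'; assumption.
Qed.

Definition FS b : M := the _ (formulas_exist b).

Lemma is_formulas_iff b F : is_formulas b F <-> F = FS b.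
Proof.
  assert (H : is_formulas b (FS b)) by exact (the_spec _ (formulas_exist b)).
  split; [|intros ->; exact H].
  intros [w [Hw [Hc Hm]]]. destruct H as [w' [Hw' [Hc' Hm']]].
  apply is_omega_iff in Hw, Hw'; subst w w'. apply subset_antisym; auto.
Qed.

Lemma FS_closed b : formula_closed b omg (FS b).
Proof.
  assert (H : is_formulas b (FS b)) by (apply is_formulas_iff; reflexivity).
  destruct H as [w [Hw [Hc _]]]. apply is_omega_iff in Hw; subst; exact Hc.
Qed.

Lemma FS_least b C : formula_closed b omg C -> subset (FS b) C.
Proof.
  assert (H : is_formulas b (FS b)) by (apply is_formulas_iff; reflexivity).
  destruct H as [w [Hw [_ Hm]]]. apply is_omega_iff in Hw; subst; apply Hm.
Qed.

Lemma FS_mem b i j : i ∈ omg -> j ∈ omg -> mk2 0 i j ∈ FS b.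
Proof.
  destruct (proj1 (formula_closed_iff b omg _) (FS_closed b)) as [? [? [? [? [? ?]]]]];
    auto.
Qed.

Lemma FS_eq b i j : i ∈ omg -> j ∈ omg -> mk2 1 i j ∈ FS b.
Proof.
  destruct (proj1 (formula_closed_iff b omg _) (FS_closed b)) as [? [? [? [? [? ?]]]]];
    auto.
Qed.

Lemma FS_fun i j : i ∈ omg -> j ∈ omg -> mk2 2 i j ∈ FS true.
Proof.
  destruct (proj1 (formula_closed_iff true omg _) (FS_closed true)) as [_ [_ [H _]]].
  apply H; reflexivity.
Qed.

Lemma FS_neg b p : p ∈ FS b -> mk1 3 p ∈ FS b.
Proof.
  destruct (proj1 (formula_closed_iff b omg _) (FS_closed b)) as [? [? [? [? [? ?]]]]];
    auto.
Qed.

Lemma FS_and b p q : p ∈ FS b -> q ∈ FS b -> mk2 4 p q ∈ FS b.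
Proof.
  destruct (proj1 (formula_closed_iff b omg _) (FS_closed b)) as [? [? [? [? [? ?]]]]];
    auto.
Qed.

Lemma FS_ex b i p : i ∈ omg -> p ∈ FS b -> mk2 5 i p ∈ FS b.
Proof.
  destruct (proj1 (formula_closed_iff b omg _) (FS_closed b)) as [? [? [? [? [? ?]]]]];
    auto.
Qed.

(** Reaches every code of [M], the nonstandard ones included; this is why [P] must be definable. *)
Lemma formula_ind b (P : M -> Prop) :
  Def1 P ->
  (forall i j, i ∈ omg -> j ∈ omg -> P (mk2 0 i j)) ->
  (forall i j, i ∈ omg -> j ∈ omg -> P (mk2 1 i j)) ->
  (b = true -> forall i j, i ∈ omg -> j ∈ omg -> P (mk2 2 i j)) ->
  (forall p, p ∈ FS b -> P p -> P (mk1 3 p)) ->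
  (forall p q, p ∈ FS b -> q ∈ FS b -> P p -> P q -> P (mk2 4 p q)) ->
  (forall i p, i ∈ omg -> p ∈ FS b -> P p -> P (mk2 5 i p)) ->
  forall c, c ∈ FS b -> P c.
Proof.
  intros HP H1 H2 H3 H4 H5 H6.
  destruct (separation P (FS b) HP) as [C HC].
  assert (H : formula_closed b omg C).
  { apply formula_closed_iff. repeat split.
    - intros i j Hi Hj. apply HC. split; [apply FS_mem; auto|auto].
    - intros i j Hi Hj. apply HC. split; [apply FS_eq; auto|auto].
    - intros Hb i j Hi Hj. apply HC. split; [subst; apply FS_fun; auto|auto].
    - intros p Hp. apply HC in Hp. destruct Hp. apply HC. split; [apply FS_neg; auto|auto].
    - intros p q Hp Hq. apply HC in Hp, Hq. destruct Hp, Hq.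
      apply HC. split; [apply FS_and; auto|auto].
    - intros i p Hi Hp. apply HC in Hp. destruct Hp.
      apply HC. split; [apply FS_ex; auto|auto]. }
  intros c Hc. apply HC. exact (FS_least b C H c Hc).
Qed.

Lemma mk2_inj m n x y x' y' : mk2 m x y = mk2 n x' y' -> m = n /\ x = x' /\ y = y'.
Proof.
  unfold mk2. intros H. apply opr_inj in H. destruct H as [H1 H2].
  apply num_inj in H1. apply opr_inj in H2. tauto.
Qed.

Lemma mk1_inj m n x x' : mk1 m x = mk1 n x' -> m = n /\ x = x'.
Proof.
  unfold mk1. intros H. apply opr_inj in H. destruct H as [H1 H2].
  apply num_inj in H1. tauto.
Qed.

Lemma mk1_mk2_neq m n x y z : m <> n -> mk1 m x <> mk2 n y z.
Proof.
  unfold mk1, mk2. intros Hn H. apply opr_inj in H. destruct H as [H1 H2].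
  apply num_inj in H1. contradiction.
Qed.

(** * Existence and uniqueness of truth sets *)

Definition tarski A (R : option M) T : Prop :=
  forall s, total_function s omg A ->
  (forall i j, i ∈ omg -> j ∈ omg -> (rel T (mk2 0 i j) s <->
     exists x y, rel s i x /\ rel s j y /\ x ∈ y)) /\
  (forall i j, i ∈ omg -> j ∈ omg -> (rel T (mk2 1 i j) s <->
     exists x y, rel s i x /\ rel s j y /\ x = y)) /\
  (has_fun R = true ->
   forall i j, i ∈ omg -> j ∈ omg -> (rel T (mk2 2 i j) s <->
     exists x y, rel s i x /\ rel s j y /\ fun_rel R x y)) /\
  (forall p, p ∈ FS (has_fun R) -> (rel T (mk1 3 p) s <-> ~ rel T p s)) /\
  (forall p q, p ∈ FS (has_fun R) -> q ∈ FS (has_fun R) ->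
     (rel T (mk2 4 p q) s <-> rel T p s /\ rel T q s)) /\
  (forall i p, i ∈ omg -> p ∈ FS (has_fun R) ->
     (rel T (mk2 5 i p) s <->
      exists s', total_function s' omg A /\
        (forall j x, j <> i -> (rel s' j x <-> rel s j x)) /\ rel T p s')).

Lemma is_truth_iff A R T : is_truth A R T <-> tarski A R T.
Proof.
  unfold is_truth, tarski, code_mem, code_eq, code_fun, code_neg, code_and, code_ex.
  split.
  - intros [w [F [Hw [HF H]]]] s Hs. apply is_omega_iff in Hw.
    apply is_formulas_iff in HF. subst w F.
    destruct (H s Hs) as [H1 [H2 [H3 [H4 [H5 H6]]]]]; clear H.
    split; [|split; [|split; [|split; [|split]]]].
    + intros i j Hi Hj. apply H1; auto; apply tagged2_iff; reflexivity.
    + intros i j Hi Hj. apply H2; auto; apply tagged2_iff; reflexivity.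
    + intros Hb i j Hi Hj. apply H3; auto; apply tagged2_iff; reflexivity.
    + intros p Hp. apply H4; auto; apply tagged_iff; reflexivity.
    + intros p q Hp Hq. apply H5; auto; apply tagged2_iff; reflexivity.
    + intros i p Hi Hp. apply H6; auto; apply tagged2_iff; reflexivity.
  - intros H. exists omg, (FS (has_fun R)).
    split; [exact is_omega_omg|split; [apply is_formulas_iff; reflexivity|]].
    intros s Hs. destruct (H s Hs) as [H1 [H2 [H3 [H4 [H5 H6]]]]]; clear H.
    split; [|split; [|split; [|split; [|split]]]].
    + intros c i j Hi Hj Hc. apply tagged2_iff in Hc; subst; auto.
    + intros c i j Hi Hj Hc. apply tagged2_iff in Hc; subst; auto.
    + intros Hb c i j Hi Hj Hc. apply tagged2_iff in Hc; subst; auto.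
    + intros c p Hp Hc. apply tagged_iff in Hc; subst; auto.
    + intros c p q Hp Hq Hc. apply tagged2_iff in Hc; subst; auto.
    + intros c i p Hi Hp Hc. apply tagged2_iff in Hc; subst; auto.
Qed.

Lemma Def_fun_rel (R : option M) (t u : unit -> (nat -> M) -> M) :
  Tm (Ms := fun _ => M) t -> Tm (Ms := fun _ => M) u ->
  Def (Ms := fun _ => M) (fun (n : unit) e => fun_rel R (t n e) (u n e)).
Proof. intros Ht Hu. destruct R as [f|]; simpl; def. Qed.

(** The truth set is obtained from the least relation between formulas and sets of
    assignments that is closed under the clauses of the recursion. *)
Section TruthExists.
Context (A : M) (R : option M).
Let W := funS omg A.
Let F := FS (has_fun R).

Definition atom_value (P : M -> M -> Prop) i j X : Prop :=
  forall s, s ∈ X <-> s ∈ funS omg A /\ exists x y, rel s i x /\ rel s j y /\ P x y.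

Definition value_step (V : M -> M -> Prop) c X : Prop :=
  (exists i j, i ∈ omg /\ j ∈ omg /\ tagged2 0 c i j /\
     atom_value (fun x y => x ∈ y) i j X) \/
  (exists i j, i ∈ omg /\ j ∈ omg /\ tagged2 1 c i j /\
     atom_value (fun x y => x = y) i j X) \/
  (has_fun R = true /\ exists i j, i ∈ omg /\ j ∈ omg /\ tagged2 2 c i j /\
     atom_value (fun x y => fun_rel R x y) i j X) \/
  (exists p Y, V p Y /\ tagged 3 c p /\
     forall s, s ∈ X <-> s ∈ funS omg A /\ ~ s ∈ Y) \/
  (exists p q Y Z, V p Y /\ V q Z /\ tagged2 4 c p q /\
     forall s, s ∈ X <-> s ∈ Y /\ s ∈ Z) \/
  (exists i p Y, i ∈ omg /\ V p Y /\ tagged2 5 c i p /\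
     forall s, s ∈ X <-> s ∈ funS omg A /\
       exists s', s' ∈ Y /\ forall j x, j <> i -> (rel s' j x <-> rel s j x)).

(** [X] is meant as the set of assignments that satisfy [c]. The bounds on [c] and [X] confine the
    closure condition to a set of pairs, so that sets [Z] suffice as competitors. *)
Definition truth_value c X : Prop :=
  c ∈ FS (has_fun R) /\ subset X (funS omg A) /\
  forall Z, (forall c X, c ∈ FS (has_fun R) -> subset X (funS omg A) ->
      value_step (rel Z) c X -> rel Z c X) -> rel Z c X.

Ltac def_named ::= first [apply Def_fun_rel | def_set_theory].

Lemma Def_truth_value (t u : unit -> (nat -> M) -> M) :
  Tm (Ms := fun _ => M) t -> Tm (Ms := fun _ => M) u ->
  Def (Ms := fun _ => M) (fun (n : unit) e => truth_value (t n e) (u n e)).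
Proof. intros Ht Hu. unfold truth_value, value_step, atom_value. def. Qed.

Ltac def_named ::=
  first [apply Def_truth_value | apply Def_fun_rel | def_set_theory].

Lemma value_step_mono (V V' : M -> M -> Prop) c X :
  (forall p Y, V p Y -> V' p Y) -> value_step V c X -> value_step V' c X.
Proof.
  intros H [K|[K|[K|[K|[K|K]]]]]; unfold value_step; auto.
  - destruct K as [p [Y [K1 K2]]]. do 3 right; left. exists p, Y; auto.
  - destruct K as [p [q [Y [Z [K1 [K2 K3]]]]]]. do 4 right; left. exists p, q, Y, Z; auto.
  - destruct K as [i [p [Y [K1 [K2 K3]]]]]. do 5 right. exists i, p, Y; auto.
Qed.

Lemma truth_value_intro c X :
  c ∈ F -> subset X W -> value_step truth_value c X -> truth_value c X.
Proof.
  intros Hc HX H. split; [exact Hc|split; [exact HX|]].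
  intros Z HZc. apply HZc; [exact Hc|exact HX|].
  apply (value_step_mono truth_value); [|exact H].
  intros p Y [_ [_ HY]]. apply HY, HZc.
Qed.

(** The fixed point argument: the pairs [Z] that come from one step applied to [truth_value] are
    truth values by [truth_value_intro], so by monotonicity [Z] is closed under the step, and the
    least closed relation lies within it. *)
Lemma truth_value_inv c X : truth_value c X -> value_step truth_value c X.
Proof.
  intros [Hc [HX H]].
  destruct (relation_exists (value_step truth_value) F (powS W)) as [Z [H1 H2]].
  { unfold value_step, atom_value. def. }
  apply (proj1 (H1 c X)). apply H. intros c' X' Hc' HX' Hs.
  apply H1. split; [exact Hc'|split; [apply powS_spec, HX'|]].
  apply (value_step_mono (rel Z)); [|exact Hs].
  intros p Y HY. apply H1 in HY. destruct HY as [Hp [HY1 HY2]].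
  apply truth_value_intro; [exact Hp|apply powS_spec, HY1|exact HY2].
Qed.

(** Unique readability: comparing the tags leaves only the clause that built the code. *)
Ltac tag_cases H He :=
  apply truth_value_inv in H; unfold value_step in H;
  destruct H as [H|[H|[H|[H|[H|H]]]]];
  [ destruct H as [i' [j' [Hi' [Hj' [He H]]]]]; apply tagged2_iff in He
  | destruct H as [i' [j' [Hi' [Hj' [He H]]]]]; apply tagged2_iff in He
  | destruct H as [_ [i' [j' [Hi' [Hj' [He H]]]]]]; apply tagged2_iff in He
  | destruct H as [p' [Y [HY [He H]]]]; apply tagged_iff in He
  | destruct H as [p' [q' [Y [Y' [HY [HY' [He H]]]]]]]; apply tagged2_iff in He
  | destruct H as [i' [p' [Y [Hi' [HY [He H]]]]]]; apply tagged2_iff in He ];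
  try (apply mk1_mk2_neq in He; [destruct He|discriminate]);
  try (symmetry in He; apply mk1_mk2_neq in He; [destruct He|discriminate]);
  [idtac..];
  first [apply mk2_inj in He | apply mk1_inj in He];
  try (destruct He as [He _]; discriminate He).

Lemma truth_value_mem i j X :
  truth_value (mk2 0 i j) X -> atom_value (fun x y => x ∈ y) i j X.
Proof. intros H. tag_cases H He. destruct He as [_ [-> ->]]. exact H. Qed.

Lemma truth_value_eq i j X :
  truth_value (mk2 1 i j) X -> atom_value (fun x y => x = y) i j X.
Proof. intros H. tag_cases H He. destruct He as [_ [-> ->]]. exact H. Qed.

Lemma truth_value_fun i j X :
  truth_value (mk2 2 i j) X -> atom_value (fun x y => fun_rel R x y) i j X.
Proof. intros H. tag_cases H He. destruct He as [_ [-> ->]]. exact H. Qed.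

Lemma truth_value_neg p X :
  truth_value (mk1 3 p) X ->
  exists Y, truth_value p Y /\ forall s, s ∈ X <-> s ∈ W /\ ~ s ∈ Y.
Proof. intros H. tag_cases H He. destruct He as [_ ->]. exists Y; auto. Qed.

Lemma truth_value_and p q X :
  truth_value (mk2 4 p q) X ->
  exists Y Z, truth_value p Y /\ truth_value q Z /\ forall s, s ∈ X <-> s ∈ Y /\ s ∈ Z.
Proof. intros H. tag_cases H He. destruct He as [_ [-> ->]]. exists Y, Y'; auto. Qed.

Lemma truth_value_ex i p X :
  truth_value (mk2 5 i p) X ->
  exists Y, truth_value p Y /\ forall s, s ∈ X <-> s ∈ W /\
    exists s', s' ∈ Y /\ forall j x, j <> i -> (rel s' j x <-> rel s j x).
Proof. intros H. tag_cases H He. destruct He as [_ [-> ->]]. exists Y; auto. Qed.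

Lemma truth_value_exists c : c ∈ F -> exists X, truth_value c X.
Proof.
  assert (Hat : forall (P : M -> M -> Prop) i j, Def2 P ->
    exists X, subset X W /\ atom_value P i j X).
  { intros P i j HP.
    destruct (separation (fun s => exists x y, rel s i x /\ rel s j y /\ P x y) W)
      as [X HX].
    - apply Def_ex, Def_ex, Def_and; [def|apply Def_and; [def|]].
      exact (Def_ren _ (fun n => match n with 0 => 1 | _ => 0 end) HP).
    - exists X. split; [intros s Hs; apply HX, Hs|exact HX]. }
  revert c. apply formula_ind; [def| | | | | |].
  - intros i j Hi Hj. destruct (Hat (fun x y => x ∈ y) i j) as [X [HX1 HX2]]; [def|].
    exists X. apply truth_value_intro; [apply FS_mem; auto|exact HX1|].
    left. exists i, j. rewrite tagged2_iff; auto.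
  - intros i j Hi Hj. destruct (Hat (fun x y => x = y) i j) as [X [HX1 HX2]]; [def|].
    exists X. apply truth_value_intro; [apply FS_eq; auto|exact HX1|].
    right; left. exists i, j. rewrite tagged2_iff; auto.
  - intros Hb i j Hi Hj.
    destruct (Hat (fun x y => fun_rel R x y) i j) as [X [HX1 HX2]]; [def|].
    exists X. apply truth_value_intro; [unfold F; rewrite Hb; apply FS_fun; auto|exact HX1|].
    do 2 right; left. split; [exact Hb|]. exists i, j. rewrite tagged2_iff; auto.
  - intros p Hp [Y HY].
    destruct (separation (fun s => ~ s ∈ Y) W) as [X HX]; [def|].
    exists X. apply truth_value_intro; [apply FS_neg, Hp|intros s Hs; apply HX, Hs|].
    do 3 right; left. exists p, Y. rewrite tagged_iff; auto.
  - intros p q Hp Hq [Y HY] [Z HZ'].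
    destruct (separation (fun s => s ∈ Z) Y) as [X HX]; [def|].
    exists X. apply truth_value_intro; [apply FS_and; auto| |].
    + intros s Hs. apply HX in Hs. apply (proj1 (proj2 HY)), Hs.
    + do 4 right; left. exists p, q, Y, Z. rewrite tagged2_iff; auto.
  - intros i p Hi Hp [Y HY].
    destruct (separation (fun s => exists s', s' ∈ Y /\
      forall j x, j <> i -> (rel s' j x <-> rel s j x)) W) as [X HX]; [def|].
    exists X. apply truth_value_intro; [apply FS_ex; auto|intros s Hs; apply HX, Hs|].
    do 5 right. exists i, p, Y. rewrite tagged2_iff; auto.
Qed.

Lemma truth_value_unique c :
  c ∈ F -> forall X X', truth_value c X -> truth_value c X' -> X = X'.
Proof.
  revert c. apply (formula_ind _ (fun c => forall X X',
    truth_value c X -> truth_value c X' -> X = X')); [def| | | | | |].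
  - intros i j _ _ X X' H H'. apply truth_value_mem in H, H'.
    apply set_ext; intros s. rewrite (H s), (H' s). tauto.
  - intros i j _ _ X X' H H'. apply truth_value_eq in H, H'.
    apply set_ext; intros s. rewrite (H s), (H' s). tauto.
  - intros _ i j _ _ X X' H H'. apply truth_value_fun in H, H'.
    apply set_ext; intros s. rewrite (H s), (H' s). tauto.
  - intros p _ IH X X' H H'. apply truth_value_neg in H, H'.
    destruct H as [Y [HY H]], H' as [Y' [HY' H']].
    rewrite (IH Y' Y HY' HY) in H'.
    apply set_ext; intros s. rewrite (H s), (H' s). tauto.
  - intros p q _ _ IHp IHq X X' H H'. apply truth_value_and in H, H'.
    destruct H as [Y [Z [HY [HZ1 H]]]], H' as [Y' [Z' [HY' [HZ2 H']]]].
    rewrite (IHp Y' Y HY' HY), (IHq Z' Z HZ2 HZ1) in H'.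
    apply set_ext; intros s. rewrite (H s), (H' s). tauto.
  - intros i p _ _ IH X X' H H'. apply truth_value_ex in H, H'.
    destruct H as [Y [HY H]], H' as [Y' [HY' H']].
    rewrite (IH Y' Y HY' HY) in H'.
    apply set_ext; intros s. rewrite (H s), (H' s). tauto.
Qed.

Lemma truth_exists : exists T, is_truth A R T.
Proof.
  destruct (relation_exists (fun c s => exists X, truth_value c X /\ s ∈ X) F W)
    as [T [HT _]]; [def|].
  assert (HT' : forall c X s, truth_value c X -> (rel T c s <-> s ∈ X)).
  { intros c X s H. rewrite HT. split.
    - intros [Hc [_ [X' [H' Hs]]]]. rewrite (truth_value_unique c Hc X X' H H'). exact Hs.
    - intros Hs. split; [apply H|split; [apply H, Hs|exists X; auto]]. }
  exists T. apply is_truth_iff. intros s Hs. assert (HsW := proj2 (funS_spec omg A s) Hs).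
  split; [|split; [|split; [|split; [|split]]]].
  - intros i j Hi Hj. destruct (truth_value_exists _ (FS_mem _ i j Hi Hj)) as [X HX].
    rewrite (HT' _ X s HX), (truth_value_mem i j X HX s). tauto.
  - intros i j Hi Hj. destruct (truth_value_exists _ (FS_eq _ i j Hi Hj)) as [X HX].
    rewrite (HT' _ X s HX), (truth_value_eq i j X HX s). tauto.
  - intros Hb i j Hi Hj. destruct (truth_value_exists (mk2 2 i j)) as [X HX].
    { unfold F. rewrite Hb. apply FS_fun; assumption. }
    rewrite (HT' _ X s HX), (truth_value_fun i j X HX s). tauto.
  - intros p Hp. destruct (truth_value_exists _ (FS_neg _ p Hp)) as [X HX].
    rewrite (HT' _ X s HX). destruct (truth_value_neg p X HX) as [Y [HY H]].
    rewrite (HT' _ Y s HY), (H s). tauto.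
  - intros p q Hp Hq. destruct (truth_value_exists _ (FS_and _ p q Hp Hq)) as [X HX].
    rewrite (HT' _ X s HX). destruct (truth_value_and p q X HX) as [Y [Z [HY [HZ1 H]]]].
    rewrite (HT' _ Y s HY), (HT' _ Z s HZ1), (H s). tauto.
  - intros i p Hi Hp. destruct (truth_value_exists _ (FS_ex _ i p Hi Hp)) as [X HX].
    rewrite (HT' _ X s HX). destruct (truth_value_ex i p X HX) as [Y [HY H]].
    rewrite (H s). split.
    + intros [_ [s' [Hs' Hv]]]. exists s'.
      split; [apply funS_spec, HY, Hs'|split; [exact Hv|apply (HT' p Y), Hs'; exact HY]].
    + intros [s' [_ [Hv Hs']]]. split; [exact HsW|]. exists s'.
      split; [apply (HT' p Y), Hs'; exact HY|exact Hv].
Qed.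

End TruthExists.

Ltac def_named ::= def_set_theory.

Lemma truth_unique A R T T' :
  tarski A R T -> tarski A R T' ->
  forall c, c ∈ FS (has_fun R) -> forall s, total_function s omg A ->
    (rel T c s <-> rel T' c s).
Proof.
  intros HT HT'. apply (formula_ind _ (fun c => forall s, total_function s omg A ->
    (rel T c s <-> rel T' c s))); [def| | | | | |].
  - intros i j Hi Hj s Hs. destruct (HT s Hs) as [H _], (HT' s Hs) as [H' _].
    rewrite H, H'; tauto.
  - intros i j Hi Hj s Hs. destruct (HT s Hs) as [_ [H _]], (HT' s Hs) as [_ [H' _]].
    rewrite H, H'; tauto.
  - intros Hb i j Hi Hj s Hs.
    destruct (HT s Hs) as [_ [_ [H _]]], (HT' s Hs) as [_ [_ [H' _]]].
    rewrite H, H'; tauto.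
  - intros p Hp IH s Hs.
    destruct (HT s Hs) as [_ [_ [_ [H _]]]], (HT' s Hs) as [_ [_ [_ [H' _]]]].
    rewrite H, H', IH; tauto.
  - intros p q Hp Hq IHp IHq s Hs.
    destruct (HT s Hs) as [_ [_ [_ [_ [H _]]]]], (HT' s Hs) as [_ [_ [_ [_ [H' _]]]]].
    rewrite H, H', IHp, IHq; tauto.
  - intros i p Hi Hp IH s Hs.
    destruct (HT s Hs) as [_ [_ [_ [_ [_ H]]]]], (HT' s Hs) as [_ [_ [_ [_ [_ H']]]]].
    rewrite H, H'; auto.
    split; intros [s' [H1 [H2 H3]]]; exists s'; (split; [exact H1|split; [exact H2|]]);
      apply (IH s' H1), H3.
Qed.

(** [satisfies] asks for some truth set. Since truth sets agree on formulas and assignments, any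
    fixed [T] decides it. *)
Lemma satisfies_iff A R T c s :
  tarski A R T -> c ∈ FS (has_fun R) -> total_function s omg A ->
  (satisfies A R c s <-> rel T c s).
Proof.
  intros HT Hc Hs. split.
  - intros [T' [HT' H]]. apply is_truth_iff in HT'.
    apply (truth_unique A R T T' HT HT' c Hc s Hs), H.
  - intros H. exists T. split; [apply is_truth_iff, HT|exact H].
Qed.

Lemma tarski_exists A R : exists T, tarski A R T.
Proof. destruct (truth_exists A R) as [T HT]. exists T; apply is_truth_iff, HT. Qed.

End Formulas.

(** * Standard formulas inside a set structure *)

(** Gives external formulas a meaning in the set [A], beside the coded satisfaction inside [M];
    [standard_code] connects the two. *)
Definition Sub {M : structure} (A : M) : structure :=
  Structure {x : M | x ∈ A} (fun x y => proj1_sig x ∈ proj1_sig y).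

Definition val {M : structure} {A : M} (x : Sub A) : M := proj1_sig x.

Definition inS {M : structure} {A : M} (x : M) (H : x ∈ A) : Sub A :=
  exist (fun x => x ∈ A) x H.

Lemma val_in {M : structure} {A : M} (x : Sub A) : val x ∈ A.
Proof. exact (proj2_sig x). Qed.

Lemma val_inj {M : structure} {A : M} (x y : Sub A) : val x = val y -> x = y.
Proof.
  destruct x as [x Hx], y as [y Hy]; simpl. intros ->.
  f_equal. apply proof_irrelevance.
Qed.

(** A strict bound on the free variables. An external sequence [e] need not be an assignment of [M],
    so only finitely many of its values can be matched by one. *)
Fixpoint var_bound (p : formula) : nat :=
  match p with
  | Fmem i j | Feq i j => S (Nat.max i j)
  | Fneg p => var_bound p
  | Fand p q => Nat.max (var_bound p) (var_bound q)
  | Fex p => pred (var_bound p)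
  end.

Section StandardFormulas.
Context {M : structure} {HZ : ZFC M}.
Implicit Types a c d f g h k o r s t u v w x y z A B C F T U W X Y Z : M.

Lemma total_function_unique f A B x y y' :
  total_function f A B -> rel f x y -> rel f x y' -> y = y'.
Proof. intros [[_ H] _]. apply H. Qed.

(* The code has to be chosen before the structure [A], and the variables may be
   nonstandard, since the fun-atoms of nonstandard formulas are translated too. *)
Lemma standard_code (p : formula) :
  forall (N : nat) (rho : nat -> M), var_bound p <= N -> (forall n, rho n ∈ omg) ->
  exists c, c ∈ FS false /\
    forall A T s (e : nat -> Sub A),
      tarski A None T -> total_function s omg A ->
      (forall n, n < N -> rel s (rho n) (val (e n))) ->
      (rel T c s <-> holds p e).
Proof.
  induction p as [i j|i j|p IH|p IHp q IHq|p IH]; simpl; intros N rho HN Hr.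
  - exists (mk2 0 (rho i) (rho j)). split; [apply FS_mem; auto|].
    intros A T s e HT Hs He. destruct (HT s Hs) as [H _]. rewrite H; auto.
    assert (Hi := He i ltac:(lia)). assert (Hj := He j ltac:(lia)). split.
    + intros [x [y [Hx [Hy Hxy]]]].
      rewrite (total_function_unique _ _ _ _ _ _ Hs Hx Hi),
        (total_function_unique _ _ _ _ _ _ Hs Hy Hj) in Hxy. exact Hxy.
    + intros Hxy. exists (val (e i)), (val (e j)). auto.
  - exists (mk2 1 (rho i) (rho j)). split; [apply FS_eq; auto|].
    intros A T s e HT Hs He. destruct (HT s Hs) as [_ [H _]]. rewrite H; auto.
    assert (Hi := He i ltac:(lia)). assert (Hj := He j ltac:(lia)). split.
    + intros [x [y [Hx [Hy Hxy]]]].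
      rewrite (total_function_unique _ _ _ _ _ _ Hs Hx Hi),
        (total_function_unique _ _ _ _ _ _ Hs Hy Hj) in Hxy. apply val_inj, Hxy.
    + intros Hxy. exists (val (e i)), (val (e j)). rewrite Hxy in *. auto.
  - destruct (IH N rho HN Hr) as [c [Hc H]].
    exists (mk1 3 c). split; [apply FS_neg, Hc|].
    intros A T s e HT Hs He. destruct (HT s Hs) as [_ [_ [_ [H' _]]]].
    rewrite H' by exact Hc. rewrite (H A T s e HT Hs He). tauto.
  - destruct (IHp N rho ltac:(lia) Hr) as [c [Hc H]].
    destruct (IHq N rho ltac:(lia) Hr) as [d [Hd K]].
    exists (mk2 4 c d). split; [apply FS_and; auto|].
    intros A T s e HT Hs He. destruct (HT s Hs) as [_ [_ [_ [_ [H' _]]]]].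
    rewrite H' by assumption. rewrite (H A T s e HT Hs He), (K A T s e HT Hs He). tauto.
  (* The quantified variable must avoid all variables in use, so that changing [s] at [k] leaves the
     values given by [e] intact. *)
  - destruct (fresh_nat rho N Hr) as [k [Hk Hfr]].
    destruct (IH (S N) (scons k rho) ltac:(lia)) as [c [Hc H]].
    { intros [|n]; simpl; auto. }
    exists (mk2 5 k c). split; [apply FS_ex; auto|].
    intros A T s e HT Hs He. destruct (HT s Hs) as [_ [_ [_ [_ [_ H']]]]].
    rewrite H' by assumption. split.
    + intros [s' [Hs' [Hv HTs']]]. destruct (proj2 Hs' k Hk) as [x Hx].
      destruct (rel_partial_function _ _ _ _ _ (proj1 Hs') Hx) as [_ HxA].
      exists (inS x HxA). apply (H A T s' _ HT Hs'); [|exact HTs'].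
      intros [|n] Hn; simpl; [exact Hx|]. apply Hv; [|apply He; lia].
      intros E. apply (Hfr n); [lia|auto].
    + intros [x Hx].
      destruct (update_exists s omg A k (val x) Hs Hk (val_in x)) as [s' [Hs' [Hkx Hv]]].
      exists s'. split; [exact Hs'|split; [exact Hv|]].
      apply (H A T s' (scons x e) HT Hs'); [|exact Hx].
      intros [|n] Hn; simpl; [exact Hkx|]. apply Hv; [|apply He; lia].
      intros E. apply (Hfr n); [lia|auto].
Qed.

Lemma binary_code (p : formula) i j :
  i ∈ omg -> j ∈ omg ->
  exists c, c ∈ FS false /\
    forall A T f, tarski A None T ->
      (forall e : nat -> Sub A, holds p e <-> rel f (val (e 0)) (val (e 1))) ->
      forall s x y, total_function s omg A -> rel s i x -> rel s j y ->
        (rel T c s <-> rel f x y).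
Proof.
  intros Hi Hj.
  (* Every variable of [p] other than 0 is sent to [j]. This is harmless because, by the hypothesis
     on [p], its truth depends on variables 0 and 1 alone. The case [i = j] is allowed. *)
  destruct (standard_code p (var_bound p) (scons i (fun _ => j)) (le_n _))
    as [c [Hc H]].
  { intros [|n]; simpl; assumption. }
  exists c. split; [exact Hc|]. intros A T f HT Hf s x y Hs Hx Hy.
  destruct (rel_partial_function _ _ _ _ _ (proj1 Hs) Hx) as [_ HxA].
  destruct (rel_partial_function _ _ _ _ _ (proj1 Hs) Hy) as [_ HyA].
  rewrite (H A T s (scons (inS x HxA) (fun _ => inS y HyA)) HT Hs).
  - rewrite Hf. simpl. tauto.
  - intros [|n] _; simpl; assumption.
Qed.

Lemma definable_in_standard (p : formula) A f :
  (forall e : nat -> Sub A, holds p e <-> rel f (val (e 0)) (val (e 1))) ->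
  definable_in A f.
Proof.
  intros Hf. destruct (binary_code p (num 0) (num 1)) as [c [Hc H]];
    try apply num_omg.
  exists omg, (FS false), c. split; [exact is_omega_omg|].
  split; [apply is_formulas_iff; reflexivity|]. split; [exact Hc|].
  intros s i0 i1 x y Hs Hi0 Hi1 Hx Hy. apply is_num_iff in Hi0, Hi1; subst.
  destruct (tarski_exists A None) as [T HT].
  rewrite (satisfies_iff A None T c s HT Hc Hs). exact (H A T f HT Hf s x y Hs Hx Hy).
Qed.

Lemma assignment_exists A (e : nat -> Sub A) (N : nat) :
  exists s, total_function s omg A /\ forall n, n < N -> rel s (num n) (val (e n)).
Proof.
  induction N as [|N [s [Hs IH]]].
  - destruct (relation_exists (fun _ y => y = val (e 0)) omg A) as [s [H1 H2]]; [def|].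
    exists s. split; [|intros n Hn; lia]. split; [split|].
    + exact H2.
    + intros a b b' H H'. apply H1 in H, H'. destruct H as [_ [_ ->]], H' as [_ [_ ->]].
      reflexivity.
    + intros a Ha. exists (val (e 0)). apply H1. split; [exact Ha|].
      split; [apply val_in|reflexivity].
  - destruct (update_exists s omg A (num N) (val (e N)) Hs (num_omg N) (val_in _))
      as [s' [Hs' [HN Hv]]].
    exists s'. split; [exact Hs'|]. intros n Hn.
    destruct (Nat.eq_dec n N) as [->|Hne]; [exact HN|].
    apply Hv; [intros E; apply Hne, num_inj, E|apply IH; lia].
Qed.

Lemma total_function_widen s w A B :
  subset A B -> total_function s w A -> total_function s w B.
Proof.
  intros HAB [[H1 H2] H3]. split; [split|]; try assumption.
  intros p Hp. destruct (H1 p Hp) as [a [b [Ha [Hb He]]]]. exists a, b; auto.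
Qed.

(** The code of [p] is chosen before the structures, so the same code and the same assignment serve
    on both sides and elementarity applies to them. *)
Lemma elementary_standard A B (p : formula) (e : nat -> Sub A) (e' : nat -> Sub B) :
  elementary A None B None -> (forall n, val (e n) = val (e' n)) ->
  (holds p e <-> holds p e').
Proof.
  intros [_ [HAB H]] He.
  destruct (standard_code p (var_bound p) num (le_n _) num_omg) as [c [Hc Hcode]].
  destruct (assignment_exists A e (var_bound p)) as [s [Hs Hse]].
  assert (HsB := total_function_widen _ _ _ _ HAB Hs).
  destruct (tarski_exists A None) as [T HT], (tarski_exists B None) as [T' HT'].
  rewrite <- (Hcode A T s e HT Hs Hse).
  rewrite <- (Hcode B T' s e' HT' HsB).
  2: { intros n Hn. rewrite <- He. apply Hse, Hn. }
  rewrite <- (satisfies_iff A None T c s HT Hc Hs).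
  rewrite <- (satisfies_iff B None T' c s HT' Hc HsB).
  apply (H omg (FS false)); auto; [exact is_omega_omg|].
  apply is_formulas_iff; reflexivity.
Qed.

Lemma elementary_definable_expansion A B f g (p : formula) :
  elementary A None B None ->
  (forall e : nat -> Sub A, holds p e <-> rel f (val (e 0)) (val (e 1))) ->
  (forall e : nat -> Sub B, holds p e <-> rel g (val (e 0)) (val (e 1))) ->
  elementary A (Some f) B (Some g).
Proof.
  intros [_ [HAB H]] Hf Hg. split; [reflexivity|split; [exact HAB|]].
  intros w F c s Hw HF Hc Hs. apply is_omega_iff in Hw. apply is_formulas_iff in HF.
  subst w F. simpl in Hc.
  destruct (tarski_exists A None) as [T HT], (tarski_exists B None) as [T' HT'].
  destruct (tarski_exists A (Some f)) as [S HS], (tarski_exists B (Some g)) as [S' HS'].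
  (* With the four truth sets fixed as parameters, the existence of a translation is a definable
     predicate of [c], as induction inside [M] demands. One [c'] must serve both structures, since
     elementarity is afterwards applied to it. *)
  assert (Htr : exists c', c' ∈ FS false /\
    (forall s, total_function s omg A -> (rel S c s <-> rel T c' s)) /\
    (forall s, total_function s omg B -> (rel S' c s <-> rel T' c' s))).
  { clear s Hs. revert c Hc. apply formula_ind; [def| | | | | |].
    - intros i j Hi Hj. exists (mk2 0 i j). split; [apply FS_mem; auto|].
      split; intros s Hs;
        [destruct (HS s Hs) as [K _], (HT s Hs) as [L _]
        |destruct (HS' s Hs) as [K _], (HT' s Hs) as [L _]]; rewrite K, L; tauto.
    - intros i j Hi Hj. exists (mk2 1 i j). split; [apply FS_eq; auto|].
      split; intros s Hs;
        [destruct (HS s Hs) as [_ [K _]], (HT s Hs) as [_ [L _]]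
        |destruct (HS' s Hs) as [_ [K _]], (HT' s Hs) as [_ [L _]]]; rewrite K, L; tauto.
    - intros _ i j Hi Hj. destruct (binary_code p i j Hi Hj) as [c [Hc Hcode]].
      exists c. split; [exact Hc|]. split; intros s Hs;
        destruct (proj2 Hs i Hi) as [x Hx], (proj2 Hs j Hj) as [y Hy].
      + rewrite (Hcode A T f HT Hf s x y Hs Hx Hy).
        destruct (HS s Hs) as [_ [_ [K _]]]. rewrite K; auto. split.
        * intros [x' [y' [Hx' [Hy' Hr]]]].
          rewrite (total_function_unique _ _ _ _ _ _ Hs Hx Hx'),
            (total_function_unique _ _ _ _ _ _ Hs Hy Hy'). exact Hr.
        * intros Hr. exists x, y. auto.
      + rewrite (Hcode B T' g HT' Hg s x y Hs Hx Hy).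
        destruct (HS' s Hs) as [_ [_ [K _]]]. rewrite K; auto. split.
        * intros [x' [y' [Hx' [Hy' Hr]]]].
          rewrite (total_function_unique _ _ _ _ _ _ Hs Hx Hx'),
            (total_function_unique _ _ _ _ _ _ Hs Hy Hy'). exact Hr.
        * intros Hr. exists x, y. auto.
    - intros q Hq [q' [Hq' [IH1 IH2]]]. exists (mk1 3 q').
      split; [apply FS_neg, Hq'|]. split; intros s Hs;
        [destruct (HS s Hs) as [_ [_ [_ [K _]]]], (HT s Hs) as [_ [_ [_ [L _]]]]
        |destruct (HS' s Hs) as [_ [_ [_ [K _]]]], (HT' s Hs) as [_ [_ [_ [L _]]]]];
        rewrite K, L, ?IH1, ?IH2; auto; tauto.
    - intros q r Hq Hr [q' [Hq' [IH1 IH2]]] [r' [Hr' [IH3 IH4]]]. exists (mk2 4 q' r').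
      split; [apply FS_and; auto|]. split; intros s Hs;
        [destruct (HS s Hs) as [_ [_ [_ [_ [K _]]]]], (HT s Hs) as [_ [_ [_ [_ [L _]]]]]
        |destruct (HS' s Hs) as [_ [_ [_ [_ [K _]]]]], (HT' s Hs) as [_ [_ [_ [_ [L _]]]]]];
        rewrite K, L by assumption;
        [rewrite (IH1 s Hs), (IH3 s Hs)|rewrite (IH2 s Hs), (IH4 s Hs)]; tauto.
    - intros i q Hi Hq [q' [Hq' [IH1 IH2]]]. exists (mk2 5 i q').
      split; [apply FS_ex; auto|]. split; intros s Hs;
        [destruct (HS s Hs) as [_ [_ [_ [_ [_ K]]]]], (HT s Hs) as [_ [_ [_ [_ [_ L]]]]]
        |destruct (HS' s Hs) as [_ [_ [_ [_ [_ K]]]]], (HT' s Hs) as [_ [_ [_ [_ [_ L]]]]]];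
        rewrite K, L by assumption; apply exists_iff_compat; intros s'; split;
        intros [H1 [H2 H3]]; (split; [exact H1|split; [exact H2|]]);
        solve [apply (IH1 s' H1), H3|apply (IH2 s' H1), H3]. }
  destruct Htr as [c' [Hc' [H1 H2]]].
  assert (HsB := total_function_widen _ _ _ _ HAB Hs).
  rewrite (satisfies_iff A (Some f) S c s HS Hc Hs).
  rewrite (satisfies_iff B (Some g) S' c s HS' Hc HsB).
  rewrite (H1 s Hs), (H2 s HsB).
  rewrite <- (satisfies_iff A None T c' s HT Hc' Hs).
  rewrite <- (satisfies_iff B None T' c' s HT' Hc' HsB).
  apply (H omg (FS false)); auto; [exact is_omega_omg|].
  apply is_formulas_iff; reflexivity.
Qed.

End StandardFormulas.

(** * Absoluteness *)

Section Absoluteness.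
Context {M : structure} {HZ : ZFC M} (U : M) (HU : closed_universe U).
Context (HUo : omg ∈ U).
(** Keeps the hierarchy inside [U]; its level V_ω bounds the set of formulas. *)
Context (HUV : forall a : M, a ∈ U -> ordinal a -> exists v, v ∈ U /\ is_V a v).
Implicit Types a b c d f g h k o p r s t u v w x y z A B C F T : Sub U.

(** The lifting lemmas move witnesses from [M] into [Sub U]: elements by transitivity, coordinates
    of pairs likewise, and functions by closure of [U]. *)
Lemma lift_mem x (z : M) : z ∈ val x -> exists z', val z' = z.
Proof.
  intros H. exists (inS z (cu_trans U HU (val x) z (val_in x) H)). reflexivity.
Qed.

Lemma lift_in (z : M) : z ∈ U -> exists z', val z' = z.
Proof. intros H. exists (inS z H). reflexivity. Qed.

Lemma abs_mem x y : x ∈ y <-> val x ∈ val y.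
Proof. reflexivity. Qed.

Lemma abs_eq x y : x = y <-> val x = val y.
Proof. split; [intros ->; reflexivity|apply val_inj]. Qed.

Lemma abs_subset x y : subset x y <-> subset (val x) (val y).
Proof.
  split.
  - intros H z Hz. destruct (lift_mem x z Hz) as [z' <-]. apply (H z'), Hz.
  - intros H z Hz. apply (H (val z)), Hz.
Qed.

Lemma abs_is_empty x : is_empty x <-> is_empty (val x).
Proof.
  split.
  - intros H z Hz. destruct (lift_mem x z Hz) as [z' <-]. apply (H z'), Hz.
  - intros H z Hz. apply (H (val z)), Hz.
Qed.

Lemma abs_is_pair p x y : is_pair p x y <-> is_pair (val p) (val x) (val y).
Proof.
  split.
  - intros H z. split.
    + intros Hz. destruct (lift_mem p z Hz) as [z' <-].
      rewrite <- !abs_eq. apply H, Hz.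
    + intros [-> | ->]; apply H; auto.
  - intros H z. rewrite !abs_eq. apply (H (val z)).
Qed.

Lemma abs_is_succ y x : is_succ y x <-> is_succ (val y) (val x).
Proof.
  split.
  - intros H z. split.
    + intros Hz. destruct (lift_mem y z Hz) as [z' <-].
      rewrite <- abs_eq. apply H, Hz.
    + intros [Hz | ->]; [|apply H; auto].
      destruct (lift_mem x z Hz) as [z' <-]. apply H; auto.
  - intros H z. rewrite abs_eq. apply (H (val z)).
Qed.

(** Here transitivity is not enough: a subset of [x] in [M] must already lie in [U]. *)
Lemma abs_is_power p x : is_power p x <-> is_power (val p) (val x).
Proof.
  split.
  - intros H z. split.
    + intros Hz. destruct (lift_mem p z Hz) as [z' <-].
      apply abs_subset, H, Hz.
    + intros Hz. destruct (lift_in z) as [z' <-].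
      { exact (cu_subset U HU (val x) z (val_in x) Hz). }
      apply H, abs_subset, Hz.
  - intros H z. rewrite abs_subset. apply (H (val z)).
Qed.

Lemma abs_is_opair p x y : is_opair p x y <-> is_opair (val p) (val x) (val y).
Proof.
  split.
  - intros H z. split.
    + intros Hz. destruct (lift_mem p z Hz) as [z' <-].
      rewrite <- !abs_is_pair. apply H, Hz.
    + intros Hz. destruct (lift_in z) as [z' <-].
      { destruct Hz as [Hz|Hz]; apply is_pair_iff in Hz; subst z;
          apply (cu_upair U HU); apply val_in. }
      rewrite <- !abs_is_pair in Hz. apply H, Hz.
  - intros H z. rewrite !abs_is_pair. apply (H (val z)).
Qed.

Lemma abs_rel r x y : rel r x y <-> rel (val r) (val x) (val y).
Proof.
  split.
  - intros [p [Hp Hr]]. exists (val p). split; [apply abs_is_opair, Hp|exact Hr].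
  - intros [p [Hp Hr]]. destruct (lift_mem r p Hr) as [p' <-].
    exists p'. split; [apply abs_is_opair, Hp|exact Hr].
Qed.

Lemma lift_rel r (x y : M) : rel (val r) x y -> exists x' y', val x' = x /\ val y' = y.
Proof.
  intros H. apply rel_iff in H.
  destruct (cu_opr_inv U HU x y) as [Hx Hy].
  { exact (cu_trans U HU (val r) _ (val_in r) H). }
  exists (inS x Hx), (inS y Hy). auto.
Qed.

Lemma abs_inductive_set w : inductive_set w <-> inductive_set (val w).
Proof.
  split.
  - intros [[o [Ho How]] H]. split.
    + exists (val o). split; [apply abs_is_empty, Ho|exact How].
    + intros x Hx. destruct (lift_mem w x Hx) as [x' <-].
      destruct (H x' Hx) as [y [Hy Hyw]]. exists (val y).
      split; [apply abs_is_succ, Hy|exact Hyw].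
  - intros [[o [Ho How]] H]. split.
    + destruct (lift_mem w o How) as [o' <-]. exists o'.
      split; [apply abs_is_empty, Ho|exact How].
    + intros x Hx. destruct (H (val x) Hx) as [y [Hy Hyw]].
      destruct (lift_mem w y Hyw) as [y' <-]. exists y'.
      split; [apply abs_is_succ, Hy|exact Hyw].
Qed.

Lemma abs_is_omega w : is_omega w <-> val w = omg.
Proof.
  split.
  - intros [Hw Hm]. apply abs_inductive_set in Hw. apply subset_antisym.
    + destruct (lift_in omg HUo) as [o Ho]. rewrite <- Ho. apply abs_subset, Hm.
      apply abs_inductive_set. rewrite Ho. apply is_omega_omg.
    + apply (proj2 is_omega_omg), Hw.
  - intros Hw. split.
    + apply abs_inductive_set. rewrite Hw. apply is_omega_omg.
    + intros v Hv. apply abs_subset. rewrite Hw.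
      apply (proj2 is_omega_omg), abs_inductive_set, Hv.
Qed.

Lemma abs_ordinal x : ordinal x <-> ordinal (val x).
Proof.
  split; intros [H1 H2]; split.
  - intros y Hy. destruct (lift_mem x y Hy) as [y' <-]. apply abs_subset, H1, Hy.
  - intros y z Hy Hz. destruct (lift_mem x y Hy) as [y' <-].
    destruct (lift_mem x z Hz) as [z' <-]. rewrite <- abs_eq. apply H2; assumption.
  - intros y Hy. apply abs_subset, H1, Hy.
  - intros y z Hy Hz. rewrite abs_eq. apply H2; assumption.
Qed.

Lemma abs_partial_function f A B :
  partial_function f A B <-> partial_function (val f) (val A) (val B).
Proof.
  split; intros [H1 H2]; split.
  - intros p Hp. destruct (lift_mem f p Hp) as [p' <-].
    destruct (H1 p' Hp) as [a [b [Ha [Hb He]]]]. exists (val a), (val b).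
    split; [exact Ha|split; [exact Hb|apply abs_is_opair, He]].
  - intros a b b' Hb Hb'. destruct (lift_rel f a b Hb) as [x [y [<- <-]]].
    destruct (lift_rel f _ b' Hb') as [_ [y' [_ <-]]].
    apply abs_eq. apply (H2 x); apply abs_rel; assumption.
  - intros p Hp. destruct (H1 (val p) Hp) as [a [b [Ha [Hb He]]]].
    destruct (lift_mem A a Ha) as [a' <-]. destruct (lift_mem B b Hb) as [b' <-].
    exists a', b'. split; [exact Ha|split; [exact Hb|apply abs_is_opair, He]].
  - intros a b b' Hb Hb'. apply abs_eq. apply (H2 (val a)); apply abs_rel; assumption.
Qed.

Lemma abs_total_function f A B :
  total_function f A B <-> total_function (val f) (val A) (val B).
Proof.
  unfold total_function. rewrite abs_partial_function.
  split; intros [H1 H2]; (split; [exact H1|]).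
  - intros a Ha. destruct (lift_mem A a Ha) as [a' <-].
    destruct (H2 a' Ha) as [b Hb]. exists (val b). apply abs_rel, Hb.
  - intros a Ha. destruct (H2 (val a) Ha) as [b Hb].
    destruct (lift_rel f _ b Hb) as [_ [b' [_ <-]]]. exists b'. apply abs_rel, Hb.
Qed.

(** As [U] misses no function between its members, bijections, cofinal maps and assignments are the
    same in [Sub U] as in [M]. Absoluteness of inaccessibility and of satisfaction rests on this. *)
Lemma lift_total_function (f : M) A B :
  total_function f (val A) (val B) -> exists f', val f' = f.
Proof.
  intros H. apply lift_in.
  apply (cu_partial_function U HU f (val A) (val B)); [apply val_in..|apply H].
Qed.

Lemma abs_equinumerous A B : equinumerous A B <-> equinumerous (val A) (val B).
Proof.
  split.
  - intros [f [H1 [H2 H3]]]. exists (val f). split; [apply abs_total_function, H1|split].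
    + intros a a' b Ha Ha'. destruct (lift_rel f a b Ha) as [x [y [<- <-]]].
      destruct (lift_rel f a' _ Ha') as [x' [_ [<- _]]].
      apply abs_eq. apply (H2 x x' y); apply abs_rel; assumption.
    + intros b Hb. destruct (lift_mem B b Hb) as [b' <-].
      destruct (H3 b' Hb) as [a Ha]. exists (val a). apply abs_rel, Ha.
  - intros [f [H1 [H2 H3]]]. destruct (lift_total_function f A B H1) as [f' <-].
    exists f'. split; [apply abs_total_function, H1|split].
    + intros a a' b Ha Ha'. apply abs_eq. apply (H2 _ _ (val b)); apply abs_rel; assumption.
    + intros b Hb. destruct (H3 (val b) Hb) as [a Ha].
      destruct (lift_rel f' a _ Ha) as [a' [_ [<- _]]]. exists a'. apply abs_rel, Ha.
Qed.

Lemma abs_cardinal k : cardinal k <-> cardinal (val k).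
Proof.
  unfold cardinal. rewrite abs_ordinal. split; intros [H1 H2]; (split; [exact H1|]).
  - intros a Ha. destruct (lift_mem k a Ha) as [a' <-].
    rewrite <- abs_equinumerous. apply H2, Ha.
  - intros a Ha. rewrite abs_equinumerous. apply H2, Ha.
Qed.

Lemma abs_regular k : regular k <-> regular (val k).
Proof.
  split.
  - intros H a g Ha Hg. destruct (lift_mem k a Ha) as [a' <-].
    destruct (lift_total_function g a' k Hg) as [g' <-].
    destruct (H a' g' Ha) as [b [Hb Hbd]]; [apply abs_total_function, Hg|].
    exists (val b). split; [exact Hb|]. intros x y Hxy.
    destruct (lift_rel g' x y Hxy) as [x' [y' [<- <-]]]. apply (Hbd x'), abs_rel, Hxy.
  - intros H a g Ha Hg. apply abs_total_function in Hg.
    destruct (H (val a) (val g) Ha Hg) as [b [Hb Hbd]].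
    destruct (lift_mem k b Hb) as [b' <-]. exists b'. split; [exact Hb|].
    intros x y Hxy. apply (Hbd (val x)), abs_rel, Hxy.
Qed.

Lemma abs_strong_limit k : strong_limit k <-> strong_limit (val k).
Proof.
  split.
  - intros H a Ha. destruct (lift_mem k a Ha) as [a' <-].
    destruct (H a' Ha) as [p [b [Hp [Hb He]]]]. exists (val p), (val b).
    split; [apply abs_is_power, Hp|split; [exact Hb|apply abs_equinumerous, He]].
  - intros H a Ha. destruct (H (val a) Ha) as [p [b [Hp [Hb He]]]].
    destruct (lift_mem k b Hb) as [b' <-].
    destruct (lift_in p) as [p' <-].
    { apply is_power_iff in Hp; subst p. apply (cu_pow U HU), val_in. }
    exists p', b'.
    split; [apply abs_is_power, Hp|split; [exact Hb|apply abs_equinumerous, He]].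
Qed.

Lemma abs_inaccessible k : inaccessible k <-> inaccessible (val k).
Proof.
  unfold inaccessible. rewrite abs_cardinal, abs_regular, abs_strong_limit.
  assert (E : (exists w, is_omega w /\ w ∈ k) <->
    (exists w : M, is_omega w /\ w ∈ val k)).
  { split.
    - intros [w [Hw H]]. apply abs_is_omega in Hw. exists (val w).
      split; [apply is_omega_iff, Hw|exact H].
    - intros [w [Hw H]]. apply is_omega_iff in Hw; subst w.
      destruct (lift_mem k omg H) as [w Hw]. exists w.
      split; [apply abs_is_omega, Hw|rewrite <- Hw in H; exact H]. }
  rewrite E. reflexivity.
Qed.

Lemma abs_is_V a v : is_V a v <-> is_V (val a) (val v).
Proof.
  split.
  - intros [Ha [h [d [B [Hd [Hh [Hc Hv]]]]]]]. split; [apply abs_ordinal, Ha|].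
    exists (val h), (val d), (val B). split; [apply abs_is_succ, Hd|].
    split; [apply abs_total_function, Hh|split; [|apply abs_rel, Hv]].
    intros b y Hy z. destruct (lift_rel h b y Hy) as [b' [y' [<- <-]]].
    apply abs_rel in Hy. split.
    + intros Hz. destruct (lift_mem y' z Hz) as [z' <-].
      apply (Hc b' y' Hy z') in Hz. destruct Hz as [c [x [H1 [H2 H3]]]].
      exists (val c), (val x).
      split; [exact H1|split; [apply abs_rel, H2|apply abs_subset, H3]].
    + intros [c [x [H1 [H2 H3]]]]. destruct (lift_rel h c x H2) as [c' [x' [<- <-]]].
      destruct (lift_in z) as [z' <-].
      { exact (cu_subset U HU (val x') z (val_in x') H3). }
      apply (Hc b' y' Hy z'). exists c', x'.
      split; [exact H1|split; [apply abs_rel, H2|apply abs_subset, H3]].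
  - intros HV. assert (HV' := HV).
    destruct HV' as [Ha [h [d [B [Hd [Hh [Hc Hv]]]]]]].
    apply is_succ_iff in Hd; subst d.
    destruct (lift_in _ (cu_succS U HU _ (val_in a))) as [d Hd].
    (* The given codomain [B] may lie outside [U]. The values of [h] are levels up to [a], hence
       subsets of [v], so the power set of [v] can replace it. *)
    destruct (lift_in _ (cu_pow U HU _ (val_in v))) as [B' HB'].
    assert (Hh' : total_function h (val d) (val B')).
    { rewrite Hd, HB'. split; [split|].
      - intros p Hp. destruct (proj1 (proj1 Hh) p Hp) as [b [y [Hb [_ He]]]].
        exists b, y. split; [exact Hb|split; [|exact He]].
        apply powS_spec. apply (V_mono (val a) (val v) b y HV).
        + apply (V_clause_is_V (val a) h B b y Ha Hh Hc).
          exists p. split; assumption.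
        + apply succS_spec, Hb.
      - apply Hh.
      - apply Hh. }
    destruct (lift_total_function h d B' Hh') as [h' <-].
    split; [apply abs_ordinal, Ha|]. exists h', d, B'.
    split; [apply abs_is_succ; rewrite Hd; apply is_succ_iff; reflexivity|].
    split; [apply abs_total_function, Hh'|split; [|apply abs_rel, Hv]].
    intros b y Hy z. apply abs_rel in Hy. rewrite (abs_mem z y), (Hc _ _ Hy (val z)).
    split.
    + intros [c [x [H1 [H2 H3]]]]. destruct (lift_rel h' c x H2) as [c' [x' [<- <-]]].
      exists c', x'. split; [exact H1|split; [apply abs_rel, H2|apply abs_subset, H3]].
    + intros [c [x [H1 [H2 H3]]]]. exists (val c), (val x).
      split; [exact H1|split; [apply abs_rel, H2|apply abs_subset, H3]].
Qed.

(** * Absoluteness of coded formulas and truth *)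

Lemma emp_in_U : emp ∈ U.
Proof. exact (cu_trans U HU omg emp HUo emp_omg). Qed.

Lemma abs_is_num n x : is_num n x <-> val x = num n.
Proof.
  revert x; induction n as [|n IH]; intros x; simpl.
  - rewrite abs_is_empty. apply is_empty_iff.
  - split.
    + intros [y [Hy Hx]]. apply IH in Hy. apply abs_is_succ, is_succ_iff in Hx.
      rewrite Hx, Hy. reflexivity.
    + intros Hx. destruct (lift_in _ (cu_num U HU n emp_in_U)) as [y Hy].
      exists y. split; [apply IH, Hy|]. apply abs_is_succ, is_succ_iff.
      rewrite Hx, Hy. reflexivity.
Qed.

Lemma abs_tagged n c x : tagged n c x <-> val c = mk1 n (val x).
Proof.
  split.
  - intros [t [Ht Hc]]. apply abs_is_num in Ht. apply abs_is_opair, is_opair_iff in Hc.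
    rewrite Hc, Ht. reflexivity.
  - intros Hc. destruct (lift_in _ (cu_num U HU n emp_in_U)) as [t Ht].
    exists t. split; [apply abs_is_num, Ht|]. apply abs_is_opair, is_opair_iff.
    rewrite Hc, Ht. reflexivity.
Qed.

Lemma abs_tagged2 n c x y : tagged2 n c x y <-> val c = mk2 n (val x) (val y).
Proof.
  split.
  - intros [p [Hp Hc]]. apply abs_tagged in Hc. apply abs_is_opair, is_opair_iff in Hp.
    rewrite Hc, Hp. reflexivity.
  - intros Hc. destruct (lift_in _ (cu_opr U HU _ _ (val_in x) (val_in y))) as [p Hp].
    exists p. split; [apply abs_is_opair, is_opair_iff, Hp|].
    apply abs_tagged. rewrite Hc, Hp. reflexivity.
Qed.

Lemma lift_mk1 n x : exists c, val c = mk1 n (val x).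
Proof.
  apply lift_in, (cu_opr U HU); [apply (cu_num U HU), emp_in_U|apply val_in].
Qed.

Lemma lift_mk2 n x y : exists c, val c = mk2 n (val x) (val y).
Proof.
  apply lift_in, (cu_opr U HU); [apply (cu_num U HU), emp_in_U|].
  apply (cu_opr U HU); apply val_in.
Qed.

Lemma abs_formula_closed (l : bool) w C :
  formula_closed l w C <-> formula_closed l (val w) (val C).
Proof.
  rewrite formula_closed_iff.
  unfold formula_closed, code_mem, code_eq, code_fun, code_neg, code_and, code_ex.
  assert (At : forall n,
    (forall c i j, i ∈ w -> j ∈ w -> tagged2 n c i j -> c ∈ C) <->
    (forall i j : M, i ∈ val w -> j ∈ val w -> mk2 n i j ∈ val C)).
  { intros n. split.
    - intros H i j Hi Hj. destruct (lift_mem w i Hi) as [i' <-].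
      destruct (lift_mem w j Hj) as [j' <-]. destruct (lift_mk2 n i' j') as [c Hc].
      rewrite <- Hc. apply (H c i' j' Hi Hj), abs_tagged2, Hc.
    - intros H c i j Hi Hj Hc. apply abs_tagged2 in Hc. rewrite abs_mem, Hc. auto. }
  assert (Ne : (forall c p, p ∈ C -> tagged 3 c p -> c ∈ C) <->
    (forall p : M, p ∈ val C -> mk1 3 p ∈ val C)).
  { split.
    - intros H p Hp. destruct (lift_mem C p Hp) as [p' <-].
      destruct (lift_mk1 3 p') as [c Hc].
      rewrite <- Hc. apply (H c p' Hp), abs_tagged, Hc.
    - intros H c p Hp Hc. apply abs_tagged in Hc. rewrite abs_mem, Hc. auto. }
  (* Covers two clauses: [D] is [C] for conjunctions and [w] for quantifiers. *)
  assert (Bi : forall n (D : Sub U),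
    (forall c i p, i ∈ D -> p ∈ C -> tagged2 n c i p -> c ∈ C) <->
    (forall i p : M, i ∈ val D -> p ∈ val C -> mk2 n i p ∈ val C)).
  { intros n D. split.
    - intros H i j Hi Hj. destruct (lift_mem D i Hi) as [i' <-].
      destruct (lift_mem C j Hj) as [j' <-]. destruct (lift_mk2 n i' j') as [c Hc].
      rewrite <- Hc. apply (H c i' j' Hi Hj), abs_tagged2, Hc.
    - intros H c i j Hi Hj Hc. apply abs_tagged2 in Hc. rewrite abs_mem, Hc. auto. }
  rewrite !At, Ne, !Bi. reflexivity.
Qed.

Lemma FS_in_U (l : bool) : FS l ∈ U.
Proof.
  destruct (HUV omg HUo ordinal_omg) as [v [Hv HV]].
  apply (cu_subset U HU v); [exact Hv|]. apply FS_least.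
  apply formula_closed_universe; [exact (V_limit_closed omg v limit_omg HV)|].
  exact (ordinal_subset_V omg v HV).
Qed.

Lemma abs_is_formulas (l : bool) F : is_formulas l F <-> val F = FS l.
Proof.
  split.
  - intros [w [Hw [Hc Hm]]]. apply abs_is_omega in Hw.
    apply abs_formula_closed in Hc. rewrite Hw in Hc. apply subset_antisym.
    + destruct (lift_in _ (FS_in_U l)) as [F' HF']. rewrite <- HF'.
      apply abs_subset, Hm. apply abs_formula_closed. rewrite Hw, HF'. apply FS_closed.
    + apply FS_least, Hc.
  - intros HF. destruct (lift_in omg HUo) as [w Hw]. exists w.
    split; [apply abs_is_omega, Hw|split].
    + apply abs_formula_closed. rewrite Hw, HF. apply FS_closed.
    + intros C HC. apply abs_subset. rewrite HF. apply FS_least.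
      rewrite <- Hw. apply abs_formula_closed, HC.
Qed.

Lemma abs_is_truth A T : is_truth A None T <-> tarski (val A) None (val T).
Proof.
  destruct (lift_in omg HUo) as [w Hw].
  destruct (lift_in _ (FS_in_U false)) as [F HF].
  assert (At : forall (n : nat) (P : Sub U -> Sub U -> Prop) (Q : M -> M -> Prop) s,
    (forall x y, P x y <-> Q (val x) (val y)) ->
    ((forall c i j, i ∈ w -> j ∈ w -> tagged2 n c i j ->
       (rel T c s <-> exists x y, rel s i x /\ rel s j y /\ P x y)) <->
     (forall i j : M, i ∈ omg -> j ∈ omg -> (rel (val T) (mk2 n i j) (val s) <->
       exists x y : M, rel (val s) i x /\ rel (val s) j y /\ Q x y)))).
  { intros n P Q s HPQ.
    assert (E : forall i j, (exists x y, rel s i x /\ rel s j y /\ P x y) <->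
      (exists x y : M, rel (val s) (val i) x /\ rel (val s) (val j) y /\ Q x y)).
    { intros i j. split.
      - intros [x [y [H1 [H2 H3]]]]. exists (val x), (val y). rewrite <- !abs_rel, <- HPQ. auto.
      - intros [x [y [H1 [H2 H3]]]].
        destruct (lift_rel s _ x H1) as [_ [x' [_ <-]]].
        destruct (lift_rel s _ y H2) as [_ [y' [_ <-]]].
        exists x', y'. rewrite !abs_rel, HPQ. auto. }
    rewrite <- Hw. split.
    - intros H i j Hi Hj. destruct (lift_mem w i Hi) as [i' <-].
      destruct (lift_mem w j Hj) as [j' <-]. destruct (lift_mk2 n i' j') as [c Hc].
      rewrite <- Hc, <- abs_rel, <- E. apply H; auto. apply abs_tagged2, Hc.
    - intros H c i j Hi Hj Hc. apply abs_tagged2 in Hc.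
      rewrite abs_rel, Hc, E. apply H; assumption. }
  (* The witnesses [w'] and [F'] inside [is_truth] are determined by absoluteness, so they can be
     replaced by the fixed [w] and [F]. *)
  assert (E : is_truth A None T <-> forall s, total_function s w A ->
    (forall c i j, i ∈ w -> j ∈ w -> code_mem c i j ->
       (rel T c s <-> exists x y, rel s i x /\ rel s j y /\ x ∈ y)) /\
    (forall c i j, i ∈ w -> j ∈ w -> code_eq c i j ->
       (rel T c s <-> exists x y, rel s i x /\ rel s j y /\ x = y)) /\
    (forall c p, p ∈ F -> code_neg c p -> (rel T c s <-> ~ rel T p s)) /\
    (forall c p q : Sub U, p ∈ F -> q ∈ F -> code_and c p q ->
       (rel T c s <-> rel T p s /\ rel T q s)) /\
    (forall c i p : Sub U, i ∈ w -> p ∈ F -> code_ex c i p ->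
       (rel T c s <->
        exists s', total_function s' w A /\
          (forall j x, j <> i -> (rel s' j x <-> rel s j x)) /\
          rel T p s'))).
  { split.
    - intros [w' [F' [Hw' [HF' H]]]]. apply abs_is_omega in Hw'.
      apply abs_is_formulas in HF'. simpl in HF'.
      assert (w' = w) by (apply val_inj; congruence).
      assert (F' = F) by (apply val_inj; congruence). subst w' F'.
      intros s Hs. destruct (H s Hs) as [H1 [H2 [_ H3]]]. auto.
    - intros H. exists w, F. split; [apply abs_is_omega, Hw|].
      split; [apply abs_is_formulas, HF|]. intros s Hs.
      destruct (H s Hs) as [H1 [H2 H3]].
      split; [exact H1|split; [exact H2|split; [discriminate|exact H3]]]. }
  rewrite E; clear E. unfold code_mem, code_eq, code_neg, code_and, code_ex. split.
  - intros H s Hs. rewrite <- Hw in Hs. destruct (lift_total_function s w A Hs) as [s' <-].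
    apply abs_total_function in Hs. destruct (H s' Hs) as [H1 [H2 [H3 [H4 H5]]]].
    rewrite <- (At 0 (fun x y => x ∈ y) (fun x y : M => x ∈ y) s'); [|reflexivity].
    rewrite <- (At 1 (fun x y => x = y) (fun x y : M => x = y) s'); [|apply abs_eq].
    split; [exact H1|split; [exact H2|split; [discriminate|]]].
    simpl has_fun. rewrite <- HF, <- Hw. split; [|split].
    + intros p Hp. destruct (lift_mem F p Hp) as [p' <-].
      destruct (lift_mk1 3 p') as [c Hc]. rewrite <- Hc, <- !abs_rel.
      apply H3; [exact Hp|apply abs_tagged, Hc].
    + intros p q Hp Hq. destruct (lift_mem F p Hp) as [p' <-].
      destruct (lift_mem F q Hq) as [q' <-].
      destruct (lift_mk2 4 p' q') as [c Hc]. rewrite <- Hc, <- !abs_rel.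
      apply H4; [exact Hp|exact Hq|apply abs_tagged2, Hc].
    + intros i p Hi Hp. destruct (lift_mem w i Hi) as [i' <-].
      destruct (lift_mem F p Hp) as [p' <-].
      destruct (lift_mk2 5 i' p') as [c Hc].
      rewrite <- Hc, <- abs_rel, (H5 c i' p' Hi Hp); [|apply abs_tagged2, Hc].
      split.
      * intros [u [Hu [Hv HT]]]. exists (val u).
        split; [apply abs_total_function, Hu|split; [|apply abs_rel, HT]].
        intros j x Hj. split; intros Hx.
        -- destruct (lift_rel u j x Hx) as [j' [x' [<- <-]]].
           apply abs_rel, Hv; [intros ->; auto|apply abs_rel, Hx].
        -- destruct (lift_rel s' j x Hx) as [j' [x' [<- <-]]].
           apply abs_rel, Hv; [intros ->; auto|apply abs_rel, Hx].
      * intros [u [Hu [Hv HT]]]. destruct (lift_total_function u w A Hu) as [u' <-].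
        exists u'. split; [apply abs_total_function, Hu|split; [|apply abs_rel, HT]].
        intros j x Hj. rewrite !abs_rel. apply Hv.
        intros E; apply Hj, abs_eq, E.
  - intros H s Hs. apply abs_total_function in Hs. rewrite Hw in Hs.
    destruct (H (val s) Hs) as [H1 [H2 [_ [H3 [H4 H5]]]]].
    simpl has_fun in *. rewrite <- HF in H3, H4, H5.
    split; [|split; [|split; [|split]]].
    + apply (At 0 (fun x y => x ∈ y) (fun x y : M => x ∈ y) s); [reflexivity|exact H1].
    + apply (At 1 (fun x y => x = y) (fun x y : M => x = y) s); [apply abs_eq|exact H2].
    + intros c p Hp Hc. apply abs_tagged in Hc. rewrite !abs_rel, Hc. apply H3, Hp.
    + intros c p q Hp Hq Hc. apply abs_tagged2 in Hc. rewrite !abs_rel, Hc.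
      apply H4; assumption.
    + rewrite <- Hw in H5. intros c i p Hi Hp Hc. apply abs_tagged2 in Hc.
      rewrite abs_rel, Hc, (H5 _ _ Hi Hp). split.
      * intros [u [Hu [Hv HT]]]. destruct (lift_total_function u w A Hu) as [u' <-].
        exists u'. split; [apply abs_total_function, Hu|split; [|apply abs_rel, HT]].
        intros j x Hj. rewrite !abs_rel. apply Hv.
        intros E; apply Hj, abs_eq, E.
      * intros [u [Hu [Hv HT]]]. exists (val u).
        split; [apply abs_total_function, Hu|split; [|apply abs_rel, HT]].
        intros j x Hj. split; intros Hx.
        -- destruct (lift_rel u j x Hx) as [j' [x' [<- <-]]].
           apply abs_rel, Hv; [intros ->; auto|apply abs_rel, Hx].
        -- destruct (lift_rel s j x Hx) as [j' [x' [<- <-]]].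
           apply abs_rel, Hv; [intros ->; auto|apply abs_rel, Hx].
Qed.

(** An arbitrary truth set may have elements outside [U]. Its restriction to pairs of a formula and
    an assignment lies in [U], and Tarski's clauses only look at such pairs. *)
Lemma tarski_in_U A : exists T, tarski (val A) None (val T).
Proof.
  destruct (tarski_exists (val A) None) as [T HT].
  destruct (relation_exists (rel T) (FS false) (funS omg (val A))) as [T' [H1 H2]]; [def|].
  assert (HTU : T' ∈ U).
  { apply (cu_subset U HU (prodS (FS false) (funS omg (val A)))).
    - apply (cu_prodS U HU); [apply FS_in_U|].
      apply (cu_subset U HU (powS (prodS omg (val A)))).
      + apply (cu_pow U HU), (cu_prodS U HU); [exact HUo|apply val_in].
      + intros f Hf. apply powS_spec, partial_function_subset.
        apply funS_spec in Hf. apply Hf.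
    - intros p Hp. destruct (H2 p Hp) as [c [s [Hc [Hs He]]]].
      apply is_opair_iff in He; subst p. apply prodS_opr; auto. }
  exists (inS T' HTU). change (tarski (val A) None T').
  assert (E : forall c s : M, c ∈ FS false -> total_function s omg (val A) ->
    (rel T' c s <-> rel T c s)).
  { intros c s Hc Hs. rewrite H1, funS_spec. tauto. }
  intros s Hs. destruct (HT s Hs) as [K1 [K2 [_ [K3 [K4 K5]]]]]. simpl has_fun in *.
  split; [|split; [|split; [discriminate|split; [|split]]]].
  - intros i j Hi Hj. rewrite E; auto. apply FS_mem; assumption.
  - intros i j Hi Hj. rewrite E; auto. apply FS_eq; assumption.
  - intros p Hp. rewrite !E; auto. apply FS_neg; assumption.
  - intros p q Hp Hq. rewrite !E; auto. apply FS_and; assumption.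
  - intros i p Hi Hp. rewrite E, K5 by (try apply FS_ex; assumption).
    apply exists_iff_compat. intros s'. split; intros [L1 [L2 L3]];
      (split; [exact L1|split; [exact L2|]]); apply (E p s'); assumption.
Qed.

Lemma abs_satisfies A c s :
  val c ∈ FS false -> total_function (val s) omg (val A) ->
  (satisfies A None c s <-> satisfies (val A) None (val c) (val s)).
Proof.
  intros Hc Hs. split.
  - intros [T [HT H]]. apply abs_is_truth in HT.
    apply (satisfies_iff _ None (val T)); [exact HT|exact Hc|exact Hs|apply abs_rel, H].
  - intros H. destruct (tarski_in_U A) as [T HT].
    apply (satisfies_iff _ None (val T)) in H; [|exact HT|exact Hc|exact Hs].
    exists T. split; [apply abs_is_truth, HT|apply abs_rel, H].
Qed.

Lemma abs_elementary A B :
  elementary A None B None <-> elementary (val A) None (val B) None.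
Proof.
  unfold elementary. rewrite abs_subset. simpl has_fun.
  split; intros [H1 [H2 H3]]; (split; [exact H1|split; [exact H2|]]).
  - intros w F c s Hw HF Hc Hs. apply is_omega_iff in Hw.
    apply is_formulas_iff in HF. subst w F.
    destruct (lift_in omg HUo) as [w Hw].
    destruct (lift_in _ (FS_in_U false)) as [F HF].
    assert (HcF := Hc). rewrite <- HF in HcF. destruct (lift_mem F c HcF) as [c' <-].
    assert (Hsw := Hs). rewrite <- Hw in Hsw.
    destruct (lift_total_function s w A Hsw) as [s' <-].
    rewrite <- !abs_satisfies; auto.
    + apply (H3 w F); [apply abs_is_omega, Hw|apply abs_is_formulas, HF|exact HcF|].
      apply abs_total_function, Hsw.
    + exact (total_function_widen _ _ _ _ H2 Hs).
  - intros w F c s Hw HF Hc Hs. apply abs_is_omega in Hw.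
    apply abs_is_formulas in HF. apply abs_total_function in Hs. rewrite Hw in Hs.
    assert (HcF : val c ∈ FS false) by (rewrite <- HF; exact Hc).
    rewrite !abs_satisfies; auto.
    + apply (H3 omg (FS false)); auto; [exact is_omega_omg|].
      apply is_formulas_iff; reflexivity.
    + exact (total_function_widen _ _ _ _ H2 Hs).
Qed.

End Absoluteness.

(** * The Menas function *)

Definition target {N : structure} (b g : N) : Prop :=
  inaccessible g /\ exists Vb Vg : N,
    is_V b Vb /\ is_V g Vg /\ elementary Vb None Vg None.

Definition target_bound {N : structure} (b d : N) : Prop :=
  ordinal d /\ forall g : N, target b g -> g ∈ d.

Definition menas {N : structure} (b d : N) : Prop :=
  ordinal b /\
  ((target_bound b d /\ forall d' : N, d' ∈ d -> ~ target_bound b d') \/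
   ((forall d' : N, ~ target_bound b d') /\ is_empty d)).

Lemma Def_target {I : Type} {Ms : I -> structure}
    (t u : forall i : I, (nat -> Ms i) -> Ms i) :
  Tm t -> Tm u -> Def (fun i e => target (t i e) (u i e)).
Proof. intros Ht Hu. unfold target. def. Qed.

Lemma Def_target_bound {I : Type} {Ms : I -> structure}
    (t u : forall i : I, (nat -> Ms i) -> Ms i) :
  Tm t -> Tm u -> Def (fun i e => target_bound (t i e) (u i e)).
Proof.
  intros Ht Hu. unfold target_bound.
  apply Def_and; [def|apply Def_all, Def_imp; [apply Def_target; tm|def]].
Qed.

Ltac def_named ::=
  first [apply Def_target | apply Def_target_bound | def_set_theory].

Lemma Def_menas {I : Type} {Ms : I -> structure}
    (t u : forall i : I, (nat -> Ms i) -> Ms i) :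
  Tm t -> Tm u -> Def (fun i e => menas (t i e) (u i e)).
Proof. intros Ht Hu. unfold menas. def. Qed.

Lemma menas_ordinal {N : structure} (b d : N) : menas b d -> ordinal b /\ ordinal d.
Proof.
  intros [Hb [[[Hd _] _]|[_ Hd]]]; (split; [exact Hb|]); [exact Hd|].
  split; [intros y Hy|intros y z Hy]; destruct (Hd y Hy).
Qed.

(** The facts about ordinals and the empty set are hypotheses because the lemma is used both for
    [M], which has them from [ZFC], and for [Sub Vg], which obtains them by absoluteness. *)
Lemma menas_unique {N : structure} (b d d' : N) :
  (forall x y : N, ordinal x -> ordinal y -> x ∈ y \/ x = y \/ y ∈ x) ->
  (forall x y : N, is_empty x -> is_empty y -> x = y) ->
  menas b d -> menas b d' -> d = d'.
Proof.
  intros Htri Hemp [_ [[H1 H2]|[H1 H2]]] [_ [[H1' H2']|[H1' H2']]].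
  - destruct (Htri d d') as [H|[H|H]]; [apply H1|apply H1'| |exact H|].
    + destruct (H2' d H H1).
    + destruct (H2 d' H H1').
  - destruct (H1' d H1).
  - destruct (H1 d' H1').
  - apply Hemp; assumption.
Qed.

(** * Agreement of an uplifting level with the universe *)

Section Menas.
Context {M : structure} {HZ : ZFC M}.
Implicit Types a b c d f g h k r s t th u v w x y z A B : M.

Lemma V_inaccessible_universe g v :
  inaccessible g -> is_V g v ->
  closed_universe v /\ omg ∈ v /\
  (forall a, a ∈ v -> ordinal a -> exists u, u ∈ v /\ is_V a u).
Proof.
  intros Hg Hv. split; [exact (V_limit_closed g v (inaccessible_limit g Hg) Hv)|].
  split.
  - apply (ordinal_subset_V g v Hv), inaccessible_omg, Hg.
  - intros a Ha Hoa. apply (V_ordinals g v a Hv Hoa) in Ha.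
    destruct (is_V_exists a Hoa) as [u Hu]. exists u. split; [|exact Hu].
    exact (V_mem g v a u Hv Hu Ha).
Qed.

Lemma abs_target g v (x y : Sub v) :
  inaccessible g -> is_V g v -> (target x y <-> target (val x) (val y)).
Proof.
  intros Hg Hv. destruct (V_inaccessible_universe g v Hg Hv) as [HU [Ho HV]].
  unfold target. rewrite (abs_inaccessible v HU Ho).
  split; intros [H1 [Vx [Vy [H2 [H3 H4]]]]]; (split; [exact H1|]).
  - exists (val Vx), (val Vy). rewrite <- !(abs_is_V v HU), <- (abs_elementary v HU Ho HV).
    auto.
  - destruct (HV (val x) (val_in x) (is_V_ordinal _ _ H2)) as [Wx [HWx HWx']].
    destruct (HV (val y) (val_in y) (is_V_ordinal _ _ H3)) as [Wy [HWy HWy']].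
    rewrite (is_V_unique _ _ _ H2 HWx') in *. rewrite (is_V_unique _ _ _ H3 HWy') in *.
    exists (inS Wx HWx), (inS Wy HWy).
    rewrite !(abs_is_V v HU), (abs_elementary v HU Ho HV). auto.
Qed.

(** A level sees only true targets, so a true bound remains one. The converse is where [uplifting]
    enters, because targets beyond the level are invisible to it. *)
Lemma target_bound_down g v (x y : Sub v) :
  inaccessible g -> is_V g v -> target_bound (val x) (val y) -> target_bound x y.
Proof.
  intros Hg Hv [H1 H2]. destruct (V_inaccessible_universe g v Hg Hv) as [HU _].
  split; [apply (abs_ordinal v HU), H1|].
  intros z Hz. apply (H2 (val z)), (abs_target g v x z Hg Hv), Hz.
Qed.

Lemma elementary_Def A B (Q : forall N : structure, (nat -> N) -> Prop)
    (e : nat -> Sub A) (e' : nat -> Sub B) :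
  Def (I := structure) (Ms := fun N => N) Q ->
  elementary A None B None -> (forall n, val (e n) = val (e' n)) ->
  (Q (Sub A) e <-> Q (Sub B) e').
Proof.
  intros HQ HAB He. destruct (Def_uniform Q HQ) as [p Hp].
  rewrite <- !Hp. exact (elementary_standard A B p e e' HAB He).
Qed.

Lemma uplifting_target k Vk th :
  uplifting k -> is_V k Vk -> ordinal th ->
  exists g Vg, inaccessible g /\ th ∈ g /\ is_V g Vg /\ elementary Vk None Vg None.
Proof.
  (* The successor turns the weak inequality in [uplifting] into [th ∈ g]. *)
  intros [_ H] HVk Hth. destruct (H (succS th) (ordinal_succS th Hth))
    as [g [Vk' [Vg [Hg [Hle [HVk' [HVg [He _]]]]]]]].
  rewrite (is_V_unique k Vk' Vk HVk' HVk) in He.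
  exists g, Vg. split; [exact Hg|split; [|auto]].
  apply (ordinal_mem_le th (succS th)); [exact (inaccessible_ordinal g Hg)| |exact Hle].
  apply succS_spec; auto.
Qed.

(** Let V_k believe that [y] bounds the targets of [x], and let [c] be a true target, possibly above
    [k]. For a target [g] of [k] above [c], V_g believes the same by elementarity, and it sees [c];
    hence [c ∈ y]. *)
Lemma target_bound_abs k Vk (x y : Sub Vk) :
  uplifting k -> is_V k Vk -> (target_bound x y <-> target_bound (val x) (val y)).
Proof.
  intros Hk HVk. assert (Hki := proj1 Hk).
  split; [|exact (target_bound_down k Vk x y Hki HVk)].
  intros H. destruct (V_inaccessible_universe k Vk Hki HVk) as [HU _].
  split; [apply (abs_ordinal Vk HU), H|].
  intros c Hc. assert (Hoc := inaccessible_ordinal c (proj1 Hc)).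
  destruct (uplifting_target k Vk c Hk HVk Hoc) as [g [Vg [Hg [Hcg [HVg He]]]]].
  assert (Hsub := proj1 (proj2 He)).
  pose (x' := inS (val x) (Hsub _ (val_in x)) : Sub Vg).
  pose (y' := inS (val y) (Hsub _ (val_in y)) : Sub Vg).
  assert (H' : target_bound x' y').
  { apply (elementary_Def Vk Vg (fun N e => target_bound (e 0) (e 1))
      (scons x (fun _ => y)) (scons x' (fun _ => y'))); [def|exact He| |exact H].
    intros [|n]; reflexivity. }
  pose (c' := inS c (ordinal_subset_V g Vg HVg c Hcg) : Sub Vg).
  apply (proj2 H' c'). apply (abs_target g Vg x' c' Hg HVg). exact Hc.
Qed.

(** A target [g] of [k] above [d] has [d] in its level, where it is still a bound. The existence of
    a bound then passes down to V_k by elementarity. *)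
Lemma target_bound_reflect k Vk (x : Sub Vk) d :
  uplifting k -> is_V k Vk -> target_bound (val x) d ->
  exists y : Sub Vk, target_bound x y.
Proof.
  intros Hk HVk Hd.
  destruct (uplifting_target k Vk d Hk HVk (proj1 Hd)) as [g [Vg [Hg [Hdg [HVg He]]]]].
  assert (Hsub := proj1 (proj2 He)).
  pose (x' := inS (val x) (Hsub _ (val_in x)) : Sub Vg).
  pose (d' := inS d (ordinal_subset_V g Vg HVg d Hdg) : Sub Vg).
  apply (elementary_Def Vk Vg (fun N e => exists y : N, target_bound (e 0) y)
    (fun _ => x) (fun _ => x')); [def|exact He|reflexivity|].
  exists d'. exact (target_bound_down g Vg x' d' Hg HVg Hd).
Qed.

Lemma menas_abs k Vk (x y : Sub Vk) :
  uplifting k -> is_V k Vk -> (menas x y <-> menas (val x) (val y)).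
Proof.
  intros Hk HVk. destruct (V_inaccessible_universe k Vk (proj1 Hk) HVk) as [HU _].
  unfold menas. rewrite (abs_ordinal Vk HU), (abs_is_empty Vk HU).
  rewrite (target_bound_abs k Vk x y Hk HVk).
  assert (E1 : (forall z : Sub Vk, z ∈ y -> ~ target_bound x z) <->
    (forall z, z ∈ val y -> ~ target_bound (val x) z)).
  { split.
    - intros H z Hz. destruct (lift_mem Vk HU y z Hz) as [z' <-].
      rewrite <- (target_bound_abs k Vk x z' Hk HVk). apply H, Hz.
    - intros H z Hz. rewrite (target_bound_abs k Vk x z Hk HVk). apply H, Hz. }
  assert (E2 : (forall z : Sub Vk, ~ target_bound x z) <->
    (forall z, ~ target_bound (val x) z)).
  { split.
    - intros H z Hz. destruct (target_bound_reflect k Vk x z Hk HVk Hz) as [z' Hz'].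
      exact (H z' Hz').
    - intros H z. rewrite (target_bound_abs k Vk x z Hk HVk). apply H. }
  rewrite E1, E2. reflexivity.
Qed.

Lemma menas_total a : ordinal a -> exists d, menas a d.
Proof.
  intros Ha. destruct (classic (exists d, target_bound a d)) as [[d Hd]|H].
  - destruct (ordinal_least (fun d => target_bound a d) d) as [m [_ [Hm Hl]]];
      [def|exact (proj1 Hd)|exact Hd|].
    exists m. split; [exact Ha|left; auto].
  - exists emp. split; [exact Ha|right]. split; [|exact emp_spec].
    intros d Hd. apply H; exists d; exact Hd.
Qed.

Lemma menas_functional a d d' : menas a d -> menas a d' -> d = d'.
Proof.
  apply menas_unique; [exact ordinal_trichotomy|].
  intros x y Hx Hy. apply is_empty_iff in Hx, Hy. congruence.
Qed.

(** If [a] has a bound, reflection yields one in V_k, say [y], which is a true bound by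
    absoluteness. The least bound [d] is then a subset of [y], hence lies in V_k. *)
Lemma menas_below k a d : uplifting k -> a ∈ k -> menas a d -> d ∈ k.
Proof.
  intros Hk Ha Hd. assert (Hok := inaccessible_ordinal k (proj1 Hk)).
  destruct (is_V_exists k Hok) as [Vk HVk].
  destruct (V_inaccessible_universe k Vk (proj1 Hk) HVk) as [HU [Ho _]].
  apply (V_ordinals k Vk d HVk (proj2 (menas_ordinal a d Hd))).
  destruct Hd as [_ [[Hd Hl]|[_ Hd]]].
  - pose (x := inS a (ordinal_subset_V k Vk HVk a Ha) : Sub Vk).
    destruct (target_bound_reflect k Vk x d Hk HVk Hd) as [y Hy].
    apply (target_bound_abs k Vk x y Hk HVk) in Hy.
    apply (cu_subset Vk HU (val y)); [apply val_in|].
    apply ordinal_not_mem; [apply Hy|apply Hd|].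
    intros H. exact (Hl _ H Hy).
  - apply is_empty_iff in Hd; subst d.
    exact (cu_trans Vk HU omg emp Ho emp_omg).
Qed.

(** [Q] lives on the external structure [Sub A], where separation of [M] does not apply directly.
    Coded truth of [p] expresses it by a predicate definable in [M]. *)
Lemma definable_relation_exists (p : formula) A (Q : Sub A -> Sub A -> Prop) :
  (forall e : nat -> Sub A, holds p e <-> Q (e 0) (e 1)) ->
  exists r, (forall x y : Sub A, rel r (val x) (val y) <-> Q x y) /\
    (forall q, q ∈ r -> exists x y : Sub A, is_opair q (val x) (val y)).
Proof.
  intros HQ.
  destruct (standard_code p (var_bound p) (scons (num 0) (fun _ => num 1)) (le_n _))
    as [c [Hc H]].
  { intros [|n]; apply num_omg. }
  destruct (tarski_exists A None) as [T HT].
  destruct (relation_exists (fun x y => exists s, total_function s omg A /\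
    rel s (num 0) x /\ rel s (num 1) y /\ rel T c s) A A) as [r [H1 H2]]; [def|].
  exists r. split.
  - intros x y. rewrite H1. split.
    + intros [_ [_ [s [Hs [Hx [Hy Hcs]]]]]].
      apply (HQ (scons x (fun _ => y))), (H A T s); auto.
      intros [|n] _; assumption.
    + intros Hxy. split; [apply val_in|split; [apply val_in|]].
      destruct (assignment_exists A (scons x (fun _ => y)) 2) as [s [Hs He]].
      assert (He0 := He 0 ltac:(lia)). assert (He1 := He 1 ltac:(lia)).
      exists s. split; [exact Hs|split; [exact He0|split; [exact He1|]]].
      apply (H A T s (scons x (fun _ => y)) HT Hs); [|apply HQ, Hxy].
      intros [|n] _; assumption.
  - intros q Hq. destruct (H2 q Hq) as [x [y [Hx [Hy He]]]].
    exists (inS x Hx), (inS y Hy). exact He.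
Qed.

(** * The value at [k] in a larger level, and the Menas property *)

Lemma next_target k Vk th :
  uplifting k -> is_V k Vk -> ordinal th ->
  exists g Vg d, inaccessible g /\ th ∈ g /\ is_V g Vg /\ elementary Vk None Vg None /\
    th ∈ d /\ exists x y : Sub Vg, val x = k /\ val y = d /\ menas x y.
Proof.
  intros Hk HVk Hth. assert (Hok := inaccessible_ordinal k (proj1 Hk)).
  (* Taking the maximum with [k] ensures [k ∈ g0], so that [k] is an element of V_g and has a value
     there. *)
  destruct (ordinal_max th k Hth Hok) as [m [Hm [Hthm [Hkm _]]]].
  destruct (uplifting_target k Vk m Hk HVk Hm) as [g0 [V0 [Hg0 [Hmg0 [HV0 He0]]]]].
  assert (Ho0 := inaccessible_ordinal g0 Hg0).
  (* [g1] only witnesses that [k] has a target above [g0]; the least such target is the one used. *)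
  destruct (uplifting_target k Vk g0 Hk HVk Ho0) as [g1 [V1 [Hg1 [H01 [HV1 He1]]]]].
  destruct (ordinal_least (fun g => target k g /\ g0 ∈ g) g1)
    as [g [Hog [[[Hg Ht] H0g] Hl]]].
  { def. }
  { exact (inaccessible_ordinal g1 Hg1). }
  { split; [|exact H01]. split; [exact Hg1|]. exists Vk, V1; auto. }
  destruct Ht as [Vk' [Vg [HVk' [HVg He]]]].
  rewrite (is_V_unique k Vk' Vk HVk' HVk) in He.
  destruct (V_inaccessible_universe g Vg Hg HVg) as [HU _].
  assert (Hth0 : th ∈ g0) by exact (ordinal_le_trans th m g0 Ho0 Hthm Hmg0).
  assert (Hk0 : k ∈ g0) by exact (ordinal_le_trans k m g0 Ho0 Hkm Hmg0).
  assert (Hkg : k ∈ Vg).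
  { apply (ordinal_subset_V g Vg HVg), (ordinal_trans g g0); assumption. }
  assert (H0V : g0 ∈ Vg) by exact (ordinal_subset_V g Vg HVg g0 H0g).
  assert (Hs0V : succS g0 ∈ Vg) by exact (cu_succS Vg HU g0 H0V).
  exists g, Vg, (succS g0).
  split; [exact Hg|split; [exact (ordinal_trans g g0 th Hog H0g Hth0)|]].
  split; [exact HVg|split; [exact He|split; [apply succS_spec; auto|]]].
  exists (inS k Hkg), (inS (succS g0) Hs0V).
  split; [reflexivity|split; [reflexivity|]].
  split; [apply (abs_ordinal Vg HU), Hok|left]. split; [split|].
  - apply (abs_ordinal Vg HU), ordinal_succS, Ho0.
  - intros z Hz. apply (abs_target g Vg _ z Hg HVg) in Hz.
    assert (Hoz := inaccessible_ordinal _ (proj1 Hz)).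
    assert (Hzg : val z ∈ g) by (apply (V_ordinals g Vg _ HVg Hoz), val_in).
    apply succS_spec.
    destruct (ordinal_trichotomy (val z) g0 Hoz Ho0) as [H|[H|H]]; auto.
    (* A target seen by V_g lies below [g], so if it were above [g0] it would contradict the
       minimality of [g]. *)
    destruct (Hl (val z) Hzg). split; [exact Hz|exact H].
  (* No smaller bound is possible, because V_g sees [g0] itself as a target of [k]. *)
  - intros z Hz [_ Hb].
    assert (H : g0 ∈ val z).
    { apply (Hb (inS g0 H0V)). apply (abs_target g Vg _ _ Hg HVg).
      split; [exact Hg0|]. exists Vk, V0; auto. }
    apply succS_spec in Hz. destruct Hz as [Hz|Hz].
    + exact (mem_asym _ _ H Hz).
    + change (val z = g0) in Hz. rewrite Hz in H. exact (mem_irrefl _ H).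
Qed.

Lemma menas_restriction k :
  uplifting k -> exists f, is_restriction menas k f /\ total_function f k k /\
    forall a b, rel f a b <-> a ∈ k /\ menas a b.
Proof.
  intros Hk. assert (Hok := inaccessible_ordinal k (proj1 Hk)).
  destruct (relation_exists (fun a b => menas a b) k k) as [f [H1 H2]];
    [apply Def_menas; tm|].
  assert (H3 : forall a b, rel f a b <-> a ∈ k /\ menas a b).
  { intros a b. rewrite H1. split; [tauto|]. intros [Ha Hab].
    split; [exact Ha|split; [exact (menas_below k a b Hk Ha Hab)|exact Hab]]. }
  exists f. split; [|split; [split; [split|]|exact H3]].
  - intros p. split.
    + intros Hp. destruct (H2 p Hp) as [a [b [Ha [Hb He]]]]. exists a, b.
      split; [exact Ha|split; [|exact He]]. apply (H3 a b). exists p; auto.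
    + intros [a [b [Ha [Hab He]]]]. apply is_opair_iff in He; subst p.
      apply rel_iff, H3; auto.
  - exact H2.
  - intros a b b' H H'. apply H3 in H, H'.
    exact (menas_functional a b b' (proj2 H) (proj2 H')).
  - intros a Ha. destruct (menas_total a (ordinal_mem k a Hok Ha)) as [d Hd].
    exists d. apply H3; auto.
Qed.

Lemma menas_holds k Vk f (p : formula) (e : nat -> Sub Vk) :
  uplifting k -> is_V k Vk ->
  (forall a b, rel f a b <-> a ∈ k /\ menas a b) ->
  (holds p e <-> menas (e 0) (e 1)) -> (holds p e <-> rel f (val (e 0)) (val (e 1))).
Proof.
  intros Hk HVk Hf Hp. rewrite Hp, Hf, (menas_abs k Vk _ _ Hk HVk).
  split; [|tauto]. intros H. split; [|exact H].
  apply (V_ordinals k Vk _ HVk (proj1 (menas_ordinal _ _ H))), val_in.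
Qed.

Lemma menas_uplifting_Menas k f (p : formula) :
  (forall (N : structure) (e : nat -> N), holds p e <-> menas (e 0) (e 1)) ->
  uplifting k -> total_function f k k ->
  (forall a b, rel f a b <-> a ∈ k /\ menas a b) -> uplifting_Menas k f.
Proof.
  intros Hp Hk Hft Hf. split; [apply Hft|]. intros th Hth.
  assert (Hok := inaccessible_ordinal k (proj1 Hk)).
  destruct (is_V_exists k Hok) as [Vk HVk].
  destruct (next_target k Vk th Hk HVk Hth)
    as [g [Vg [d [Hg [Hthg [HVg [He [Hthd [x [y [Hx [Hy Hxy]]]]]]]]]]]].
  destruct (V_inaccessible_universe g Vg Hg HVg) as [HU _].
  destruct (definable_relation_exists p Vg menas (Hp (Sub Vg))) as [fs [H1 H2]].
  exists g, fs, Vk, Vg. split; [exact Hg|split; [exact Hthg|split; [split|]]].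
  - intros q Hq. destruct (H2 q Hq) as [a [b Hq']].
    assert (Hab : menas a b) by (apply H1; exists q; auto).
    apply menas_ordinal in Hab. rewrite !(abs_ordinal Vg HU) in Hab.
    exists (val a), (val b). split; [|split; [|exact Hq']].
    + apply (V_ordinals g Vg _ HVg (proj1 Hab)), val_in.
    + apply (V_ordinals g Vg _ HVg (proj2 Hab)), val_in.
  - assert (Hlift : forall a b, rel fs a b ->
      exists a' b' : Sub Vg, val a' = a /\ val b' = b /\ menas a' b').
    { intros a b H. assert (H' := H). apply rel_iff in H'.
      destruct (H2 _ H') as [a' [b' E]]. apply is_opair_iff, opr_inj in E.
      destruct E as [-> ->]. exists a', b'. split; [reflexivity|split; [reflexivity|]].
      apply H1, H. }
    intros a b b' H H'. destruct (Hlift _ _ H) as [u [v [Hu [Hv Huv]]]].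
    destruct (Hlift _ _ H') as [u' [v' [Hu' [Hv' Huv']]]].
    assert (u' = u) by (apply val_inj; congruence). subst u' b b'.
    f_equal. apply (menas_unique u); [| |exact Huv|exact Huv'].
    + intros w z Hw Hz. apply (abs_ordinal Vg HU) in Hw, Hz.
      rewrite (abs_eq Vg). exact (ordinal_trichotomy _ _ Hw Hz).
    + intros w z Hw Hz. apply (abs_is_empty Vg HU), is_empty_iff in Hw, Hz.
      apply val_inj; congruence.
  - split; [exact HVk|split; [exact HVg|split]].
    + apply (elementary_definable_expansion Vk Vg f fs p He).
      * intros e. apply (menas_holds k Vk f p e Hk HVk Hf), Hp.
      * intros e. rewrite Hp, H1. reflexivity.
    + exists d. split; [|left; exact Hthd]. subst. apply H1, Hxy.
Qed.

End Menas.

Theorem theorem4p4 :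
  exists phi : formula, forall M : structure, ZFC M ->
    (exists F : M -> M -> Prop,
       defines phi F /\ ord_class_function F /\
       forall k : M, uplifting k ->
         exists f Vk : M,
           is_restriction F k f /\ total_function f k k /\
           is_V k Vk /\ definable_in Vk f /\ uplifting_Menas k f) /\
    (forall k : M, uplifting k ->
       exists f : M, total_function f k k /\ uplifting_Menas k f).
Proof.
  (* [phi] is fixed before [M] and is later read in the levels of [M] as well, so it must be free of
     parameters and correct in every structure. *)
  destruct (Def_uniform (fun N e => menas (e 0) (e 1))) as [phi Hphi].
  { apply Def_menas; tm. }
  exists phi. intros M HZ. split.
  - exists menas. split; [exact (Hphi M)|split; [split|]].
    + intros a b. apply menas_ordinal.
    + intros a Ha. destruct (menas_total a Ha) as [d Hd]. exists d.
      split; [exact Hd|]. intros d' Hd'. exact (menas_functional a d d' Hd Hd').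
    + intros k Hk. destruct (menas_restriction k Hk) as [f [H1 [H2 H3]]].
      destruct (is_V_exists k (inaccessible_ordinal k (proj1 Hk))) as [Vk HVk].
      exists f, Vk. split; [exact H1|split; [exact H2|split; [exact HVk|split]]].
      * apply (definable_in_standard phi). intros e.
        apply (menas_holds k Vk f phi e Hk HVk H3), Hphi.
      * exact (menas_uplifting_Menas k f phi Hphi Hk H2 H3).
  - intros k Hk. destruct (menas_restriction k Hk) as [f [H1 [H2 H3]]].
    exists f. split; [exact H2|].
    exact (menas_uplifting_Menas k f phi Hphi Hk H2 H3).
Qed.
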